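(* Let $N\in\mathbb{N}$, let $\mathcal{E}$ be a Hilbert space, and let $$K(z,z')=\sum_{w,w'\in\mathcal{F}_N}K_{w,w'}z^w z'^{\,w'^{\top}}\in\mathcal{L}(\mathcal{E})\langle\langle z,z'\rangle\rangle$$ be a formal power series in $2N$ non-commuting indeterminates which is convergent with respect to a set of connected open neighbourhoods $U_n$ of $0$ in $(\mathbb{C}^{n\times n})^N$, $n\in\mathbb{N}$. Then $K(z,z')$ is a positive non-commutative kernel if and only if for every $n\in\mathbb{N}$ the function $$K(Z,Z')=\sum_{w,w'\in\mathcal{F}_N}K_{w,w'}\otimes Z^w (Z'^* )^{w'^{\top}},\qquad Z,Z'\in U_n,$$ is a positive $\mathcal{L}(\mathcal{E}\otimes\mathbb{C}^n)$-valued kernel on $U_n$.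
   Context: Hilbert spaces are complex; $\mathcal{L}(\mathcal{E})$ is the algebra of bounded linear operators on $\mathcal{E}$. $\mathcal{F}_N$ is the free semigroup with unit $\emptyset$ (the empty word) on generators $g_1,\ldots,g_N$, with concatenation as multiplication. For $w=g_{j_1}\cdots g_{j_m}\in\mathcal{F}_N$, the transpose is $w^{\top}=g_{j_m}\cdots g_{j_1}$ and the length is $|w|=m$; $\emptyset^{\top}=\emptyset$, $|\emptyset|=0$. Put $z^w=z_{j_1}\cdots z_{j_m}$, $z^{\emptyset}=1$. $\mathcal{L}\langle\langle z_1,\ldots,z_d\rangle\rangle$ is the space of all formal power series in non-commuting indeterminates with coefficients in the vector space $\mathcal{L}$. For $Z=(Z_1,\ldots,Z_N)\in(\mathbb{C}^{n\times n})^N$ put $Z^w=Z_{j_1}\cdots Z_{j_m}$, $Z^{\emptyset}=I_n$, $Z^*=(Z_1^*,\ldots,Z_N^* )$. Positive kernel: for a set $\Omega$ and a Hilbert space $\mathcal{G}$, a function $K\colon\Omega\times\Omega\to\mathcal{L}(\mathcal{G})$ is a positive $\mathcal{L}(\mathcal{G})$-valued kernel on $\Omega$ if for any integer $l$, any $\omega^{(1)},\ldots,\omega^{(l)}\in\Omega$ and any $h^{(1)},\ldots,h^{(l)}\in\mathcal{G}$ one has $\sum_{j,k=1}^l\langle K(\omega^{(j)},\omega^{(k)})h^{(k)},h^{(j)}\rangle_{\mathcal{G}}\geq 0$. Positive non-commutative kernel: the series $K(z,z')$ is a positive non-commutative kernel if $(w,w')\mapsto K_{w,w'}$ is a positive $\mathcal{L}(\mathcal{E})$-valued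 kernel on $\mathcal{F}_N$. Convergence: $K(z,z')$ is convergent with respect to the connected open neighbourhoods $U_n$ of $0$ in $(\mathbb{C}^{n\times n})^N$, $n\in\mathbb{N}$, if for every $n\in\mathbb{N}$ the series $\sum_{w,w'\in\mathcal{F}_N}K_{w,w'}\otimes Z^w(Z'^* )^{w'^{\top}}$ converges uniformly on compact subsets of $U_n\times U_n$ in the norm of $\mathcal{L}(\mathcal{E}\otimes\mathbb{C}^n)$. Here the pairs $(w,w')$ are taken in a fixed enumeration and the sum is the limit of the corresponding partial sums (say, the pair $(w,w')$ is identified with the monomial $z^wz'^{\,w'^{\top}}$, and these words in $2N$ letters are ordered by length and then lexicographically). *)

(* Defs.v *)
From HB Require Import structures.
From mathcomp Require Import all_boot all_order all_algebra sesquilinear.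
From mathcomp Require Import complex.
From mathcomp Require Import all_classical all_reals all_analysis.

Set Implicit Arguments.
Unset Strict Implicit.
Unset Printing Implicit Defensive.
Local Set Warnings "-redundant-canonical-projection".

Import Order.TTheory GRing.Theory Num.Theory.
Import numFieldNormedType.Exports.

Local Open Scope classical_set_scope.
Local Open Scope ring_scope.

(* [complex] only provides the algebra of [R[i]]; the topology is needed for
   matrices over [R[i]]. *)
HB.instance Definition _ (R : realType) := NormedModule.copy R[i] R[i]^o.

(* As everywhere in [sesquilinear], forms are linear in the first variable and
   conjugate-linear in the second one. *)
HB.mixin Record isHilbert (R : realType) E & CompleteNormedModule R[i] E := {
  inner : {dot E for (@Num.conj R[i])} ;
  inner_normE : forall x : E, `|x| ^+ 2 = inner x x
}.

#[short(type="hilbertType")]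
HB.structure Definition Hilbert (R : realType) :=
  {E of CompleteNormedModule R[i] E & isHilbert R E}.

Arguments inner {R E} : rename.

Section BoundedOperators.
Variable R : realType.

Definition bounded_op (V W : normedModType R[i]) : {pred V -> W} :=
  fun f => `[< linear f /\ exists M : R, forall x, `|f x| <= M%:C%C * `|x| >].

Record bop (V W : normedModType R[i]) :=
  Bop { bop_fun :> V -> W ; bop_funP : bop_fun \in @bounded_op V W }.

Variables V W : normedModType R[i].
Implicit Types (f g : bop V W) (x : V).

HB.instance Definition _ := [isSub for @bop_fun V W].
HB.instance Definition _ := [Choice of bop V W by <:].

Lemma bounded_op_submod : submod_closed (@bounded_op V W).
Proof.
split.
  apply/asboolP; split; first by move=> a u v; rewrite /= scaler0 addr0.
  by exists 0 => x; rewrite mul0r normr0.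
move=> a f g /asboolP[lf [M Mf]] /asboolP[lg [M' Mg]]; apply/asboolP; split.
  move=> b u v.
  change (a *: f (b *: u + v) + g (b *: u + v)
     = b *: (a *: f u + g u) + (a *: f v + g v)).
  by rewrite lf lg !scalerDr !scalerA (mulrC b a) addrACA.
exists (complex.Re `|a| * M + M') => x.
change (`|a *: f x + g x| <= (complex.Re `|a| * M + M')%:C%C * `|x|).
have -> : (complex.Re `|a| * M + M')%:C%C = `|a| * M%:C%C + M'%:C%C :> R[i].
  by rewrite rmorphD rmorphM -[X in _ = X * _ + _](RRe_real (normr_real a)).
rewrite mulrDl (le_trans (ler_normD _ _))// lerD// normrZ -mulrA.
by rewrite ler_wpM2l.
Qed.

HB.instance Definition _ :=
  GRing.isSubmodClosed.Build R[i] (V -> W) (@bounded_op V W)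
    (GRing.submod_closed_semi bounded_op_submod).
HB.instance Definition _ := [SubChoice_isSubLmodule of bop V W by <:].

Lemma bop_linear f : linear f.
Proof. by have /asboolP[] := bop_funP f. Qed.

Lemma bop_bounded f : exists M : R, forall x, `|f x| <= M%:C%C * `|x|.
Proof. by have /asboolP[] := bop_funP f. Qed.

HB.instance Definition _ f :=
  GRing.isLinear.Build R[i] V W *:%R (bop_fun f) (bop_linear f).

Lemma bopD f g x : (f + g) x = f x + g x. Proof. by []. Qed.

Lemma bopZ (a : R[i]) f x : (a *: f) x = a *: f x. Proof. by []. Qed.

Lemma bop_ext f g : f =1 g -> f = g.
Proof. by move=> fg; apply/val_inj/funext. Qed.

(* Norms over [R[i]] are [R[i]]-valued, hence the real parts. *)
Definition opnorm f : R :=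
  sup [set complex.Re `|f x| | x in [set x : V | `|x| <= 1]].

Fact Re_norm (X : normedModType R[i]) (x : X) : (complex.Re `|x|)%:C%C = `|x|.
Proof. exact: (RRe_real (normr_real x)). Qed.

Fact Re_le (a b : R[i]) : a <= b -> complex.Re a <= complex.Re b.
Proof. by rewrite lecE => /andP[]. Qed.

Fact lecR (a b : R) : (a%:C%C <= b%:C%C :> R[i]) = (a <= b).
Proof. by rewrite lecE /= eqxx. Qed.

Fact opnorm_has_sup f :
  has_sup [set complex.Re `|f x| | x in [set x : V | `|x| <= 1]].
Proof.
split; first by exists (complex.Re `|f 0|), 0 => //=; rewrite normr0 ler01.
have [M Mf] := bop_bounded f; exists `|M| => _ [x /= x1 <-].
apply: (@Re_le _ `|M|%:C%C).
apply: (le_trans (Mf x)); apply: (@le_trans _ _ (`|M|%:C%C * `|x|)).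
  by rewrite ler_wpM2r// lecR ler_norm.
by rewrite ler_piMr// lecR.
Qed.

Lemma opnorm_ge0 f : 0 <= opnorm f.
Proof.
have [_ ub] := opnorm_has_sup f; apply: (le_trans _ (ub_le_sup ub _)).
  by apply: (lexx 0).
by exists 0; rewrite /= ?linear0 normr0 //= ler01.
Qed.

Lemma ler_opnorm f x : `|f x| <= (opnorm f)%:C%C * `|x|.
Proof.
have [->|x0] := eqVneq x 0; first by rewrite linear0 !normr0 mulr0.
have [_ ub] := opnorm_has_sup f.
rewrite -ler_pdivrMr ?normr_gt0//.
have -> : `|f x| / `|x| = `|f (`|x|^-1 *: x)|.
  by rewrite linearZ normrZ normfV normr_id mulrC.
rewrite -Re_norm lecR; apply: ub_le_sup => //.
by exists (`|x|^-1 *: x) => //=; rewrite normrZ normfV normr_id mulVf ?normr_eq0.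
Qed.

Lemma opnorm_le f (M : R[i]) : 0 <= M ->
  (forall x, `|f x| <= M * `|x|) -> (opnorm f)%:C%C <= M.
Proof.
move=> M0 Mf; rewrite -[M](RRe_real (ger0_real M0)) lecR.
apply: ge_sup; first by have [] := opnorm_has_sup f.
move=> _ [x /= x1 <-]; apply: Re_le.
by rewrite (le_trans (Mf x))// ler_piMr.
Qed.

Definition opnormC f : R[i] := (opnorm f)%:C%C.

Fact opnormC_ge0 f : 0 <= opnormC f.
Proof. by rewrite /opnormC lecR opnorm_ge0. Qed.

Fact opnormD f g : opnormC (f + g) <= opnormC f + opnormC g.
Proof.
apply: opnorm_le => [|x]; first by rewrite addr_ge0 ?opnormC_ge0.
by rewrite mulrDl (le_trans (ler_normD _ _))// lerD// ler_opnorm.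
Qed.

Fact opnormZ_le (a : R[i]) f : opnormC (a *: f) <= `|a| * opnormC f.
Proof.
apply: opnorm_le => [|x]; first by rewrite mulr_ge0 ?opnormC_ge0.
by rewrite bopZ normrZ -mulrA ler_wpM2l// ler_opnorm.
Qed.

Fact opnormZ (a : R[i]) f : opnormC (a *: f) = `|a| * opnormC f.
Proof.
apply/eqP; rewrite eq_le opnormZ_le /=.
have [->|a0] := eqVneq a 0; first by rewrite normr0 mul0r opnormC_ge0.
rewrite mulrC -ler_pdivlMr ?normr_gt0// mulrC -normfV.
by rewrite -[f in leLHS](scalerK a0) opnormZ_le.
Qed.

Fact opnorm_eq0 f : opnormC f = 0 -> f = 0.
Proof.
move=> f0; apply: bop_ext => x; apply/eqP; rewrite -normr_le0.
by have := ler_opnorm f x; rewrite -/(opnormC f) f0 mul0r.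
Qed.

HB.instance Definition _ :=
  Lmodule_isNormed.Build R[i] (bop V W) opnormD opnormZ opnorm_eq0.

Lemma bop_normE f : `|f| = (opnorm f)%:C%C. Proof. by []. Qed.

End BoundedOperators.

Notation "''L' ( E )" := (bop E E) (format "''L' ( E )") : type_scope.

Section DotNorm.
Variables (C : numClosedFieldType) (U : lmodType C).
Variable form : {dot U for (@Num.conj C)}.

Lemma dot_CauchySchwarz (u v : U) :
  `|form u v| <= sqrtC (form u u) * sqrtC (form v v).
Proof.
rewrite -(@ler_pXn2r _ 2)// ?nnegrE ?mulr_ge0 ?sqrt_dnorm_ge0//.
rewrite exprMn !sqrtCK.
have [->|v0] := eqVneq v 0; first by rewrite !(linear0r form) normr0 expr0n mulr0.
have vv0 : form v v != 0 by rewrite dnorm_eq0.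
have vv_gt0 : 0 < form v v by rewrite dnorm_gt0.
have := dnorm_ge0 form (u - (form u v / form v v) *: v).
have cvv : (form v v)^* = form v v by rewrite geC0_conj// dnorm_ge0.
rewrite dnormB dnormZ (linearZr_LR form)/=.
have -> : (form u v / form v v)^* * form u v = `|form u v| ^+ 2 / form v v.
  by rewrite rmorphM fmorphV/= cvv mulrAC normCK (mulrC (form u v)).
have r : (`|form u v| ^+ 2 / form v v)^* = `|form u v| ^+ 2 / form v v.
  by rewrite geC0_conj// divr_ge0// ?exprn_ge0// dnorm_ge0.
rewrite r normrM normfV (ger0_norm (dnorm_ge0 _ _)) exprMn.
have -> : `|form u v| ^+ 2 * (form v v)^-1 ^+ 2 * form v v
    = `|form u v| ^+ 2 / form v v.
  by rewrite expr2 -!mulrA mulVf// mulr1.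
by rewrite opprD addrA addrK subr_ge0 ler_pdivrMr.
Qed.

Lemma dot_normD (u v : U) : sqrtC (form (u + v) (u + v)) <=
  sqrtC (form u u) + sqrtC (form v v).
Proof.
rewrite -(@ler_pXn2r _ 2)// ?nnegrE ?addr_ge0 ?sqrt_dnorm_ge0//.
rewrite sqrrD !sqrtCK dnormD addrAC lerD2r lerD2l.
have -> : form u v + (form u v)^* = 'Re (form u v) *+ 2.
  by rewrite ReE -mulr_natr divfK ?pnatr_eq0.
rewrite lerMn2r /=; apply: le_trans (dot_CauchySchwarz u v).
by rewrite (le_trans (real_ler_norm (Creal_Re _)))// leif_normC_Re_Creal.
Qed.

End DotNorm.

(* Elements are the families [h] standing for [\sum_i h i \otimes e_i], [e] being
   the standard basis of [C^n]; see [tens_elemE] and [inner_elem]. *)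
Definition tens (R : realType) (E : hilbertType R) (n : nat) : Type :=
  {ffun 'I_n -> E}.

Section Tensor.
Variables (R : realType) (E : hilbertType R) (n : nat).

HB.instance Definition _ := GRing.Lmodule.on (tens E n).

Implicit Types g h : tens E n.

Lemma tensD g h i : (g + h) i = g i + h i. Proof. by rewrite ffunE. Qed.

Lemma tensN h i : (- h) i = - h i. Proof. by rewrite ffunE. Qed.

Lemma tensZ (a : R[i]) h i : (a *: h) i = a *: h i.
Proof. by rewrite ffunE. Qed.

Definition tens_inner g h : R[i] := \sum_i inner (g i) (h i).

Fact tens_inner_bilinear : bilinear_for
  (GRing.Scale.Law.clone _ _ ( *%R ) _)
  (GRing.Scale.Law.clone _ _ ((@Num.conj R[i]) \; *%R) _) tens_inner.
Proof.
split=> [h a g g'|g a h h']; rewrite /tens_inner /= mulr_sumr -big_split /=;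
  apply: eq_bigr => i _; rewrite tensD tensZ.
  by rewrite linearDl linearZl_LR.
by rewrite linearDr linearZr_LR.
Qed.

HB.instance Definition _ := bilinear_isBilinear.Build R[i]
  (tens E n) (tens E n) R[i] _ _ tens_inner tens_inner_bilinear.

Fact tens_inner_hermitian g h :
  tens_inner g h = (-1) ^+ false * Num.conj (tens_inner h g).
Proof.
rewrite mul1r /tens_inner rmorph_sum; apply: eq_bigr => i _ /=.
by rewrite [LHS]hermC mul1r.
Qed.

HB.instance Definition _ := isHermitianSesquilinear.Build R[i]
  (tens E n) false Num.conj tens_inner tens_inner_hermitian.

Fact tens_inner_gt0 h : h != 0 -> 0 < tens_inner h h.
Proof.
move=> h0; rewrite lt_def; apply/andP; split; last first.
  by apply: sumr_ge0 => i _; exact: dnorm_ge0.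
apply: contra h0 => /eqP /psumr_eq0P h0; apply/eqP/ffunP => i; rewrite ffunE.
by apply/eqP; rewrite -(dnorm_eq0 inner) h0// => j _; exact: dnorm_ge0.
Qed.

HB.instance Definition _ := isDotProduct.Build R[i]
  (tens E n) tens_inner tens_inner_gt0.

Definition tens_dot : {dot (tens E n) for (@Num.conj R[i])} := tens_inner.

Definition tens_norm h : R[i] := sqrtC (tens_dot h h).

Fact tens_normD g h : tens_norm (g + h) <= tens_norm g + tens_norm h.
Proof. exact: dot_normD. Qed.

Fact tens_normZ (a : R[i]) h : tens_norm (a *: h) = `|a| * tens_norm h.
Proof.
by rewrite /tens_norm dnormZ rootCMl ?exprn_ge0// sqrCK.
Qed.

Fact tens_norm_eq0 h : tens_norm h = 0 -> h = 0.
Proof. by move/eqP; rewrite sqrt_dnorm_eq0 => /eqP. Qed.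

HB.instance Definition _ :=
  Lmodule_isNormed.Build R[i] (tens E n) tens_normD tens_normZ tens_norm_eq0.

Lemma tens_normE h : `|h| ^+ 2 = tens_dot h h.
Proof. exact: sqrtCK. Qed.

Lemma tens_norm_sum h : `|h| ^+ 2 = \sum_i `|h i| ^+ 2.
Proof. by rewrite tens_normE; apply: eq_bigr => i _; rewrite inner_normE. Qed.

Lemma tens_coord_le h i : `|h i| <= `|h|.
Proof.
rewrite -(@ler_pXn2r _ 2)// ?nnegrE// tens_norm_sum (bigD1 i)//= lerDl.
by apply: sumr_ge0 => j _; rewrite exprn_ge0.
Qed.

Lemma tens_norm_le_sum h : `|h| <= \sum_i `|h i|.
Proof.
have s0 : 0 <= \sum_i `|h i| by apply: sumr_ge0.
rewrite -(@ler_pXn2r _ 2)// ?nnegrE// tens_norm_sum expr2 mulr_suml.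
apply: ler_sum => i _; rewrite expr2 ler_wpM2l// (bigD1 i)//= lerDl.
exact: sumr_ge0.
Qed.

Fact tens_complete (F : set_system (tens E n)) :
  ProperFilter F -> cauchy F -> cvg F.
Proof.
move=> FF /cauchy_ballP Fc; apply/cvg_ex.
have cF i : cvg ((fun h : tens E n => h i) @ F).
  apply/cauchy_cvgP/cauchy_ballP => e e0; rewrite near_map2.
  apply: filterS (Fc e e0) => -[g h] /=; rewrite -!ball_normE /ball_ /=.
  by apply: le_lt_trans; rewrite -tensN -tensD tens_coord_le.
exists ([ffun i => lim ((fun h : tens E n => h i) @ F)] : tens E n).
apply: (proj2 (cvgrPdist_le idfun _)) => e e0; near=> h.
apply: le_trans (tens_norm_le_sum _) _.
apply: (@le_trans _ _ (\sum_(i < n) e / n%:R)); last first.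
  rewrite sumr_const card_ord -[leLHS]mulr_natr -mulrA.
  by case: (n) => [|k]; rewrite ?mulr0 ?(ltW e0)// mulVf ?mulr1// pnatr_eq0.
apply: ler_sum => i _; rewrite tensD tensN ffunE.
move: i; near: h; apply: filter_forall => i.
have n0 : 0 < e / n%:R by rewrite divr_gt0// ltr0n (leq_ltn_trans _ (ltn_ord i)).
by have /cvgrPdist_le /(_ _ n0) := cF i.
Unshelve. all: by end_near. Qed.

HB.instance Definition _ :=
  Uniform_isComplete.Build (tens E n) tens_complete.

HB.instance Definition _ := isHilbert.Build R (tens E n) tens_normE.

Definition tens_elem (x : E) (v : 'cV[R[i]]_n) : tens E n :=
  [ffun i => v i 0 *: x].

Lemma tens_elemE h : h = \sum_i tens_elem (h i) (delta_mx i 0).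
Proof.
apply/ffunP => i; rewrite sum_ffunE (bigD1 i)//= ffunE mxE !eqxx scale1r.
rewrite big1 ?addr0// => j ji; rewrite ffunE mxE eq_sym (negbTE ji) scale0r.
by [].
Qed.

Lemma inner_elem (x y : E) (v w : 'cV[R[i]]_n) :
  inner (tens_elem x v) (tens_elem y w)
  = inner x y * \sum_i v i 0 * Num.conj (w i 0).
Proof.
rewrite mulr_sumr; apply: eq_bigr => i _; rewrite !ffunE.
by rewrite (linearZl_LR inner)/= (linearZr_LR inner)/= mulrA mulrC.
Qed.

End Tensor.

Section OperatorTensor.
Variables (R : realType) (E : hilbertType R) (n : nat).

Definition optens_fun (A : 'L(E)) (M : 'M[R[i]]_n) (h : tens E n) : tens E n :=
  [ffun i => \sum_j M i j *: A (h j)].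

Fact optens_bounded (A : 'L(E)) (M : 'M[R[i]]_n) :
  optens_fun A M \in @bounded_op R (tens E n) (tens E n).
Proof.
apply/asboolP; split=> [a u v|].
  apply/ffunP => i; rewrite tensD tensZ !ffunE scaler_sumr -big_split /=.
  apply: eq_bigr => j _; rewrite tensD tensZ linearP scalerDr !scalerA.
  by rewrite (mulrC a).
exists (complex.Re (\sum_i \sum_j `|M i j| * `|A|)) => h.
rewrite RRe_real; last first.
  by apply: ger0_real; do 2!apply: sumr_ge0 => ? _; rewrite mulr_ge0.
apply: le_trans (tens_norm_le_sum _) _; rewrite mulr_suml.
apply: ler_sum => i _; rewrite ffunE mulr_suml.
apply: le_trans (ler_norm_sum _ _ _) _; apply: ler_sum => j _.
rewrite normrZ -mulrA ler_wpM2l// (le_trans (ler_opnorm _ _))//.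
by apply: ler_wpM2l; [exact: opnormC_ge0 | exact: tens_coord_le].
Qed.

(* [A \otimes M]; see [optens_elem]. *)
Definition optens (A : 'L(E)) (M : 'M[R[i]]_n) : 'L(tens E n) :=
  Bop (optens_bounded A M).

Lemma optens_elem (A : 'L(E)) (M : 'M[R[i]]_n) (x : E) (v : 'cV[R[i]]_n) :
  optens A M (tens_elem x v) = tens_elem (A x) (M *m v).
Proof.
apply/ffunP => i; rewrite !ffunE mxE scaler_suml; apply: eq_bigr => j _.
by rewrite ffunE linearZ scalerA.
Qed.

End OperatorTensor.

Definition positive_kernel (R : realType) (G : hilbertType R) (T : Type)
    (Omega : set T) (K : T -> T -> 'L(G)) : Prop :=
  forall (l : nat) (omega : 'I_l -> T) (h : 'I_l -> G),
    (forall j, Omega (omega j)) ->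
    0 <= \sum_j \sum_k inner (K (omega j) (omega k) (h k)) (h j).

(* The free semigroup on [g_0, ..., g_(N-1)]: concatenation is [++], the
   transpose is [rev] and the length is [size]. *)
Definition word (N : nat) := seq 'I_N.

Section Enumeration.
Variable N : nat.

(* The monomial [z^w z'^(w'^T)] as a word in the [2N] letters
   [z_0 < ... < z_(N-1) < z'_0 < ... < z'_(N-1)]. *)
Definition monomial (p : word N * word N) : seq 'I_(N + N) :=
  map (lshift N) p.1 ++ map (@rshift N N) (rev p.2).

Fixpoint words (m : nat) : seq (word N) :=
  if m is m'.+1 then [seq j :: w | j <- enum 'I_N, w <- words m']
  else [:: [::]].

(* The pairs whose monomial has length [m], in lexicographic order of the
   monomials; see [mem_pairs] and [pairs_lexi]. *)
Fixpoint pairs (m : nat) : seq (word N * word N) :=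
  if m is m'.+1 then
    [seq (j :: p.1, p.2) | j <- enum 'I_N, p <- pairs m']
      ++ [seq ([::], rev w) | w <- words m'.+1]
  else [:: ([::], [::])].

(* The first [k] pairs, ordered by length and then lexicographically.  There is
   at least one pair of each length, unless [N = 0] in which case
   [([::], [::])] is the only pair. *)
Definition first_pairs (k : nat) : seq (word N * word N) :=
  take k (flatten [seq pairs m | m <- iota 0 k]).

Lemma pairsS m : pairs m.+1 =
  [seq (j :: p.1, p.2) | j <- enum 'I_N, p <- pairs m]
    ++ [seq ([::], rev w) | w <- words m.+1].
Proof. by []. Qed.

Lemma mem_words m w : (w \in words m) = (size w == m).
Proof.
elim: m w => [|m IH] [|j w] //=; first by apply/allpairsPdep => -[? [? []]].
rewrite eqSS -IH; apply/allpairsPdep/idP => [[i [v [_ vm [_ ->]]]] //|wm].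
by exists j, w; rewrite mem_enum.
Qed.

Lemma mem_pairs m p : (p \in pairs m) = (size p.1 + size p.2 == m)%N.
Proof.
elim: m p => [|m IH] [w w'].
  by rewrite inE xpair_eqE addn_eq0 !size_eq0.
rewrite pairsS mem_cat.
have -> : ((w, w') \in [seq ([::], rev v) | v <- words m.+1])
    = (w == [::]) && (size w' == m.+1).
  apply/mapP/andP => [[v vm [-> ->]]|[/eqP -> w'm]].
    by rewrite eqxx size_rev -mem_words.
  by exists (rev w'); rewrite ?revK// mem_words size_rev.
case: w => [|j w].
  rewrite add0n eqxx /=; apply: orb_idl.
  by move=> /allpairsPdep[i [q [_ _]]].
rewrite (_ : (j :: w == [::]) = false)// andFb orbF [(_, _).1]/= addSn eqSS -(IH (w, w')).
apply/allpairsPdep/idP => [[i [[v v'] [_ qm [_ -> ->]]]] //|wm].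
by exists j, (w, w'); rewrite mem_enum.
Qed.

Local Notation "s <l t" := ((s : seqlexi 'I_(N + N)) < t)%O (at level 70).

Fact lexi_allpairs (A : eqType) (sigma : 'I_N -> 'I_(N + N))
    (g : A -> seq 'I_(N + N)) (t : seq A) :
    {homo sigma : i j / (i < j)%N >-> (i < j)%N} ->
    pairwise (fun a b => g a <l g b) t ->
  pairwise (fun p q => sigma p.1 :: g p.2 <l sigma q.1 :: g q.2)
    [seq (j, a) | j <- enum 'I_N, a <- t].
Proof.
move=> sigma_lt tP.
have : pairwise (fun i j : 'I_N => (i < j)%N) (enum 'I_N).
  rewrite -(pairwise_map val ltn) val_enum_ord.
  by rewrite -sorted_pairwise ?iota_ltn_sorted//; exact: ltn_trans.
elim: (enum 'I_N) => [//|j s IH] /andP[js sP].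
rewrite allpairs_cons pairwise_cat (IH sP) andbT pairwise_map.
apply/andP; split.
  apply/allrelP => _ _ /mapP[a _ ->] /allpairsPdep[i [b [si _ ->]]].
  rewrite ltxi_cons /=.
  have ji : (sigma j < sigma i)%O by apply/sigma_lt/(allP js).
  by rewrite (ltW ji) leNgt ji.
apply: sub_pairwise tP => a b /=.
by rewrite ltxi_cons !lexx.
Qed.

Lemma pairs_lexi m :
  pairwise (fun p q => monomial p <l monomial q) (pairs m).
Proof.
have words_lexi k : pairwise
    (fun v w => map (@rshift N N) v <l map (@rshift N N) w) (words k).
  elim: k => // k IH.
  have -> : words k.+1 = [seq q.1 :: q.2 | q <-
      [seq (j, w) | j <- enum 'I_N, w <- words k]] by rewrite map_allpairs.
  rewrite pairwise_map; apply: (lexi_allpairs (sigma := @rshift N N)) IH.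
  by move=> i j ij; rewrite /= ltn_add2l.
elim: m => // m IH; rewrite pairsS pairwise_cat; apply/and3P; split.
- apply/allrelP => _ y /allpairsPdep[i [q [_ _ ->]]].
  move=> /mapP[v + ->]; case: v => [|j w] wm; first by move: wm; rewrite mem_words.
  rewrite /monomial revK /= ltxi_cons.
  have ij : (lshift N i < rshift N j)%O.
    by rewrite ltEord /= (leq_trans (ltn_ord i))// leq_addr.
  by rewrite (ltW ij) leNgt ij.
- have -> : [seq (j :: p.1, p.2) | j <- enum 'I_N, p <- pairs m] =
    [seq (r.1 :: r.2.1, r.2.2) | r <-
      [seq (j, p) | j <- enum 'I_N, p <- pairs m]] by rewrite map_allpairs.
  rewrite pairwise_map.
  exact: (lexi_allpairs (sigma := @lshift N N) (g := @monomial)) IH.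
- rewrite pairwise_map; apply: sub_pairwise (words_lexi m.+1) => v w.
  by rewrite /monomial /= !revK.
Qed.

Lemma size_first_pairs k : (0 < N)%N -> size (first_pairs k) = k.
Proof.
move=> N0; rewrite size_take_min; apply/minn_idPl.
rewrite size_flatten /shape -map_comp -[leqLHS](size_iota 0) -sum1_size.
rewrite sumnE big_map; apply: leq_sum => m _ /=.
rewrite lt0n size_eq0; apply/eqP => m0.
have := mem_pairs m (nseq m (Ordinal N0), [::]).
by rewrite m0 /= size_nseq addn0 eqxx.
Qed.

End Enumeration.

Section MatrixEvaluation.
Variables (R : realType) (N : nat).

(* An [N]-tuple of [n x n] matrices is a row of matrices; its topology is the
   entrywise one. *)
Local Notation mxtuple n := 'rV['M[R[i]]_n]_N.

Definition mxtuple_pow n (Z : mxtuple n) (w : word N) : 'M[R[i]]_n :=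
  \prod_(j <- w) Z 0 j.

Definition mxtuple_adj n (Z : mxtuple n) : mxtuple n :=
  \row_j map_mx Num.conj (Z 0 j)^T.

Variable E : hilbertType R.

(* [K w w'] is the coefficient of [z^w z'^(w'^T)]. *)
Implicit Type K : word N -> word N -> 'L(E).

Definition nc_term K n (Z Z' : mxtuple n) (p : word N * word N) :
    'L(tens E n) :=
  optens (K p.1 p.2)
    (mxtuple_pow Z p.1 *m mxtuple_pow (mxtuple_adj Z') (rev p.2)).

Definition nc_psum K n (k : nat) (Z Z' : mxtuple n) : 'L(tens E n) :=
  \sum_(p <- first_pairs N k) nc_term K Z Z' p.

Definition nc_eval K n (Z Z' : mxtuple n) : 'L(tens E n) :=
  limn (fun k => nc_psum K k Z Z').

Definition nc_convergent K (U : forall n, set (mxtuple n)) : Prop :=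
  forall n, {family compactly_in (U n `*` U n),
    (fun k (ZZ : mxtuple n * mxtuple n) => nc_psum K k ZZ.1 ZZ.2) @ \oo -->
    (fun ZZ : mxtuple n * mxtuple n => nc_eval K ZZ.1 ZZ.2)}.

Definition positive_nc_kernel K : Prop := positive_kernel [set: word N] K.

End MatrixEvaluation.

(* The limit [nc_eval] is the pointwise one in operator norm, so that convergence
   amounts to uniform convergence to it on compact subsets of [U n `*` U n]. *)
Lemma nc_convergentP (R : realType) (N : nat) (E : hilbertType R)
    (K : word N -> word N -> 'L(E)) (U : forall n, set 'rV['M[R[i]]_n]_N) :
  nc_convergent K U <->
  forall n (C : set ('rV['M[R[i]]_n]_N * 'rV['M[R[i]]_n]_N)),
    C `<=` U n `*` U n -> compact C ->
    forall e : R[i], 0 < e -> \forall k \near \oo, forall ZZ, C ZZ ->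
      `|nc_eval K ZZ.1 ZZ.2 - nc_psum K k ZZ.1 ZZ.2| < e.
Proof.
split=> [cv n C CU cC e e0|cv n].
  have /fam_cvgP/(_ C (conj CU cC)) := cv n.
  move=> cvC.
  apply: (cvC [set f | forall ZZ, C ZZ -> `|nc_eval K ZZ.1 ZZ.2 - f ZZ| < e]).
  apply/uniform_nbhs; exists [set xy | ball xy.1 e xy.2]; split.
    by rewrite -entourage_ballE; exists e.
  by move=> f /= Hf ZZ CZZ; have := Hf ZZ CZZ; rewrite -ball_normE.
apply/fam_cvgP => C [CU cC] A /uniform_nbhs[B [entB BA]].
have [e e0 eB] : exists2 e : R[i], 0 < e & [set xy | ball xy.1 e xy.2] `<=` B.
  by move: entB; rewrite -entourage_ballE => -[e e0 eB]; exists e.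
apply: filterS (cv n C CU cC e e0) => k Hk; apply: BA => ZZ CZZ; apply: eB => /=.
by rewrite -ball_normE; exact: Hk.
Qed.

(* Main.v *)
Require Import Defs.
From mathcomp Require Import all_boot all_order all_algebra.
From mathcomp Require Import all_solvable all_field sesquilinear.
From mathcomp Require Import complex zify ring lra.
From mathcomp Require Import all_classical all_reals all_analysis.
Import numFieldNormedType.Exports.
Import Order.TTheory GRing.Theory Num.Theory.
Local Open Scope classical_set_scope.
Local Open Scope ring_scope.
Set Implicit Arguments.
Unset Strict Implicit.
Unset Printing Implicit Defensive.

(** For tensors $h,h'$ one has
    $\langle K_{w,w'}\otimes Z^w(Z'^{w'})^*h',h\rangle
      =\sum_b\langle K_{w,w'}((Z'^{w'})^*h')_b,((Z^w)^*h)_b\rangle$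
    ([inner_nc_term]), so a value of the kernel at matrices is a combination of
    values of the form $\sum_{w,w'}\langle K_{w,w'}x_{w'},x_w\rangle$, and the
    whole question is one of summation.

    If the matrix kernels are positive, evaluate them at truncated and scaled
    creation operators on the words of length below $D$: these tuples are
    nilpotent, so the series is a finite sum, and they can be taken arbitrarily
    small.  The sum over $b$ is reduced to the vacuum $b=\emptyset$ by using two
    points, $Z$ and $VZV$, where $V$ is the diagonal sign matrix fixing the vacuum
    and negating the other words; the components at $b\neq\emptyset$ cancel.  What
    remains is the coefficient kernel on the words of length below $D$
    ([nc_eval_ge0_words]).

    Conversely, let the coefficient kernel be positive.  Square truncations,
    over $|w|<D$ and $|w'|<D$, are positive, but the partial sums go by total
    length, and on $U_n\times U_n$ the series need not converge when its two
    variables are scaled independently.  Near the origin the points can be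
    scaled, and the Cauchy estimates on a bidisc then make the square truncations
    converge ([positive_kernel_near0]).  From there positivity is continued
    analytically: if the kernel is positive on an open set containing $p$, then it
    is positive on a ball about $p$ as well ([positive_kernel_extend]).  Indeed,
    along complex lines through $p$ it is a limit of polynomials in
    $(s,\bar t)$, bounded on a bidisc of radius $2$, and a combination of the
    values on a small circle reproduces the value at $s=1$ up to terms of high
    degree, which are small.  Both steps pass through [damped_limit_ge0].  The
    radius of the ball depends only on the distance to the complement of $U_n$, so
    a maximal open set of positivity is relatively closed in $U_n$, hence all of
    it ([positive_kernel_connected]). *)

(** * Averages over roots of unity *)

Section RootsOfUnity.
Variable C : numClosedFieldType.

Lemma prim_root_exists n : (0 < n)%N -> exists z : C, n.-primitive_root z.
Proof.
move=> n_gt0; pose p : {poly C} := 'X^n - 1.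
have [r Dp] := closed_field_poly_normal p.
rewrite (monicP _) ?monicXnsubC // scale1r in Dp.
have rn1 : all n.-unity_root r by apply/allP => z; rewrite -root_prod_XsubC -Dp.
have sz_r : (n < (size r).+1)%N.
  by rewrite -(size_prod_XsubC r id) -Dp size_XnsubC.
have [|z] := hasP (has_prim_root n_gt0 rn1 _ sz_r); last by exists z.
by rewrite -separable_prod_XsubC -Dp separable_Xn_sub_1 // pnatr_eq0 -lt0n.
Qed.

Lemma norm_prim_root n (z : C) : n.-primitive_root z -> `|z| = 1.
Proof.
move=> zn; have n0 := prim_order_gt0 zn.
apply/eqP; rewrite -(pexpr_eq1 n0)// -normrX.
by rewrite prim_expr_order ?normr1.
Qed.

Lemma sum_prim_root n (z : C) a : n.-primitive_root z ->
  \sum_(i < n) (z ^+ i) ^+ a = if (n %| a)%N then n%:R else 0.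
Proof.
move=> zn; case: ifPn => [/dvdnP[q ->]|na].
  rewrite (eq_bigr (fun=> 1)) ?sumr_const ?card_ord// => i _.
  by rewrite -exprM mulnA mulnC exprM (prim_expr_order zn) expr1n.
have za : z ^+ a != 1 by rewrite -(prim_order_dvd zn).
apply: (mulfI (x := z ^+ a - 1)); first by rewrite subr_eq0.
rewrite mulr0; under eq_bigr do rewrite -exprM mulnC exprM.
by rewrite -subrX1 -exprM mulnC exprM (prim_expr_order zn) expr1n subrr.
Qed.

(** Up to the factor $r^a$, the $a$-th coefficient is the mean of $p(rz)z^{-a}$
    over sufficiently many roots of unity $z$: this replaces the Cauchy
    integral. *)
Lemma cauchy_estimate (p : {poly C}) (r B : C) a : 0 <= r ->
  (forall x, `|x| = r -> `|p.[x]| <= B) -> `|p`_a| * r ^+ a <= B.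
Proof.
(* With this order no exponent of [p] other than [a] is congruent to [a]. *)
move=> r0 pB; pose n := (size p + a).+1.
have [z zn] := prim_root_exists (ltn0Sn _ : (0 < n)%N).
have z1 i : `|z ^+ i| = 1 by rewrite normrX (norm_prim_root zn) expr1n.
have an : (a < n)%N by rewrite ltnS leq_addl.
have mean : \sum_(i < n) p.[r * z ^+ i] * (z ^+ i) ^+ (n - a)
    = n%:R * (p`_a * r ^+ a).
  under eq_bigr => i _.
    rewrite (@horner_coef_wide _ n); last by rewrite leqW// leq_addr.
    rewrite mulr_suml; under eq_bigr do
      rewrite exprMn mulrA -mulrA -exprD.
    over.
  rewrite exchange_big /=; under eq_bigr do rewrite -mulr_sumr sum_prim_root//.
  rewrite (bigD1 (Ordinal an))//= subnKC ?(ltnW an)// dvdnn mulrC.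
  rewrite big1 ?addr0// => b ba; case: ifPn => [|_]; last by rewrite mulr0.
  case/dvdnP => q bq; case/negP: ba; apply/eqP/val_inj => /=.
  have bn := ltn_ord b; case: q bq => [|[|q]]; rewrite ?mulSn.
  - by move: an; clear; lia.
  - by move: an; clear; lia.
  - by move: an bn; clear; lia.
have n0 : (0 : C) < n%:R by rewrite ltr0n.
rewrite -(ler_pM2l n0) -{1}(ger0_norm (exprn_ge0 a r0)).
rewrite -{1}(ger0_norm (ltW n0)) -!normrM -mean.
apply: le_trans (ler_norm_sum _ _ _) _.
rewrite mulr_natl -[X in _ *+ X](card_ord n) -sumr_const; apply: ler_sum => i _.
by rewrite normrM normrX z1 expr1n mulr1 pB// normrM z1 mulr1 ger0_norm.
Qed.

(** The functional $p\mapsto\sum_i u_i p(s_i)$ averages over the circle of radius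
    $\varepsilon$ so that it reproduces every polynomial of degree below $D$ at
    the point $1$, and damps the higher powers. *)
Lemma extrapolation_nodes D (eps : C) : (0 < D)%N -> 0 < eps <= 1 ->
  exists u s : 'I_D -> C, exists m : nat -> C,
  [/\ forall i, `|s i| = eps,
      forall a, \sum_i u i * s i ^+ a = m a,
      forall a, (a < D)%N -> m a = 1 &
      forall a, 0 <= m a <= 1].
Proof.
move=> D0 /andP[e0 e1]; have [z zD] := prim_root_exists D0.
(* The discrete Fourier coefficients, rescaled from radius [eps] to radius 1. *)
exists (fun i => D%:R^-1 * \sum_(d < D) eps ^- d * (z ^+ i) ^+ (D - d)).
exists (fun i => eps * z ^+ i), (fun a => eps ^+ (a - a %% D)); split.
- move=> i; rewrite normrM normrX (norm_prim_root zD) expr1n mulr1.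
  by rewrite gtr0_norm.
- move=> a; under eq_bigr => i _.
    rewrite -mulrA mulr_suml.
    under eq_bigr do rewrite exprMn mulrACA -exprD.
    over.
  rewrite -mulr_sumr exchange_big /=.
  under eq_bigr do rewrite -mulr_sumr sum_prim_root//.
  have aD : (a %% D < D)%N by rewrite ltn_mod.
  rewrite (bigD1 (Ordinal aD))//= big1 ?addr0 => [|d da].
    have -> : (D %| D - a %% D + a)%N.
      by rewrite {2}(divn_eq a D) addnCA subnK ?(ltnW aD)// dvdn_add ?dvdn_mull.
    rewrite mulrC mulfK ?pnatr_eq0 -?lt0n//= expfB_cond.
      by rewrite mulrC.
    by rewrite (gt_eqF e0) leq_mod.
  case: ifPn => [Dda|_]; last by rewrite mulr0.
  case/negP: da; apply/eqP/val_inj => /=.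
  have dD := ltn_ord d.
  have : (d + (D - d + a) = d %[mod D])%N.
    by rewrite -modnDmr (eqP Dda) addn0.
  by rewrite addnA subnKC ?(ltnW dD)// modnDl (modn_small dD).
- by move=> a aD; rewrite modn_small// subnn expr0.
- by move=> a; rewrite exprn_ge0 ?(ltW e0)//= exprn_ile1// ltW.
Qed.

End RootsOfUnity.

(** * Damping the coefficients of a polynomial in two variables *)

Section Truncation.
Variable C : numClosedFieldType.
Implicit Types (c : nat -> nat -> C) (m : nat -> C).

Lemma bipoly_cauchy_estimate c d (B : C) a b :
  (forall s t : C, `|s| = 2 -> `|t| = 2 ->
    `|\sum_(i < d) \sum_(j < d) c i j * s ^+ i * t ^+ j| <= B) ->
  (a < d)%N -> (b < d)%N -> `|c a b| <= B * 2^-1 ^+ a * 2^-1 ^+ b.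
Proof.
move=> cB ad bd; pose p t := \poly_(i < d) \sum_(j < d) c i j * t ^+ j.
pose q := \poly_(j < d) (c a j : C).
have p_eq s t : (p t).[s] = \sum_(i < d) \sum_(j < d) c i j * s ^+ i * t ^+ j.
  rewrite horner_poly; apply: eq_bigr => i _; rewrite mulr_suml.
  by apply: eq_bigr => j _; rewrite mulrAC.
have q_eq t : q.[t] = (p t)`_a by rewrite coef_poly ad horner_poly.
have c_q : c a b = q`_b by rewrite coef_poly bd.
rewrite c_q !exprVn ler_pdivlMr ?exprn_gt0//.
apply: cauchy_estimate => // t t2.
rewrite q_eq ler_pdivlMr ?exprn_gt0//.
by apply: cauchy_estimate => // s s2; rewrite p_eq cB.
Qed.

Lemma sum_geometric_tail d D :
  \sum_(a < d) ((D <= a)%N%:R * 2^-1 ^+ a : C) <= 2 * 2^-1 ^+ D.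
Proof.
suff /(canRL (addrK _)) -> : \sum_(a < d) ((D <= a)%N%:R * 2^-1 ^+ a : C)
    + 2 * 2^-1 ^+ maxn d D = 2 * 2^-1 ^+ D.
  by rewrite lerBlDr lerDl mulr_ge0// exprn_ge0// invr_ge0.
elim: d => [|d IH]; first by rewrite big_ord0 add0r max0n.
rewrite big_ord_recr /= -[RHS]IH -addrA; congr (_ + _).
have [Dd|dD] := leqP D d.
  rewrite (maxn_idPl (leqW Dd)) mul1r exprS mulrA divff//.
  by rewrite mul1r mulrDl mul1r.
by rewrite mul0r add0r (maxn_idPr dD).
Qed.

(** A bipolynomial bounded on the torus of radius $2$ has coefficients decaying
    like $2^{-a-b}$, so a damping of the coefficients of order at least $D$
    hardly changes its value at $(1,1)$, whatever its degree. *)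
Lemma damping_error c d (B : C) D m :
  (forall s t : C, `|s| = 2 -> `|t| = 2 ->
    `|\sum_(i < d) \sum_(j < d) c i j * s ^+ i * t ^+ j| <= B) ->
  (forall a, (a < D)%N -> m a = 1) -> (forall a, 0 <= m a <= 1) ->
  `|\sum_(a < d) \sum_(b < d) c a b - \sum_(a < d) \sum_(b < d) c a b * m a * m b|
  <= 8 * B * 2^-1 ^+ D.
Proof.
move=> cB m1 m01.
have B0 : 0 <= B.
  by apply: le_trans (cB 2 2 (normr_nat _ _) (normr_nat _ _)).
pose h a : C := 2^-1 ^+ a; pose k a : C := (D <= a)%N%:R * h a.
have h0 a : 0 <= h a by rewrite exprn_ge0// invr_ge0.
have k0 a : 0 <= k a by rewrite mulr_ge0.
have hsum : \sum_(a < d) h a <= 2.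
  have := sum_geometric_tail d 0; rewrite expr0 mulr1; apply: le_trans.
  by apply: ler_sum => a _; rewrite mul1r.
have ksum : \sum_(a < d) k a <= 2 * h D by exact: sum_geometric_tail.
apply: (@le_trans _ _ (\sum_(a < d) \sum_(b < d) B * (k a * h b + h a * k b))).
  rewrite -sumrB; under eq_bigr do rewrite -sumrB.
  apply: le_trans (ler_norm_sum _ _ _) _; apply: ler_sum => a _.
  apply: le_trans (ler_norm_sum _ _ _) _; apply: ler_sum => b _.
  have cab := bipoly_cauchy_estimate cB (ltn_ord a) (ltn_ord b).
  have [/andP[aD bD]|] := boolP ((a < D) && (b < D))%N.
    rewrite !m1// !mulr1 subrr normr0.
    by apply: mulr_ge0 => //; apply: addr_ge0; apply: mulr_ge0.
  rewrite negb_and -!leqNgt => Dab.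
  apply: (@le_trans _ _ (B * (h a * h b))).
    rewrite mulrA; apply: le_trans cab.
    rewrite -mulrA -{1}[c a b]mulr1 -mulrBr normrM ler_piMr//.
    have /andP[ma0 ma1] := m01 a; have /andP[mb0 mb1] := m01 b.
    rewrite ger0_norm ?subr_ge0 ?mulr_ile1//.
    by rewrite lerBlDr lerDl mulr_ge0.
  apply: ler_wpM2l => //; rewrite /k.
  case/orP: Dab => ->; first by rewrite mul1r lerDl mulr_ge0// mulr_ge0.
  by rewrite !mul1r lerDr mulr_ge0// mulr_ge0.
have -> : \sum_(a < d) \sum_(b < d) B * (k a * h b + h a * k b)
    = B * (2 * ((\sum_(a < d) k a) * (\sum_(a < d) h a))).
  transitivity (B * \sum_(a < d) \sum_(b < d) (k a * h b + h a * k b)).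
    by rewrite mulr_sumr; apply: eq_bigr => a _; rewrite mulr_sumr.
  congr (_ * _); under eq_bigr do rewrite big_split /= -mulr_sumr -mulr_sumr.
  rewrite big_split /= -!mulr_suml [X in _ + X]mulrC.
  by rewrite mulrDl mul1r.
rewrite [8 * B]mulrC -mulrA; apply: ler_wpM2l => //.
have -> : 8 * 2^-1 ^+ D = 2 * ((2 * h D) * 2) :> C by rewrite /h; ring.
apply: ler_wpM2l => //; apply: ler_pM => //; exact: sumr_ge0.
Qed.

End Truncation.

Section ComplexLimits.
Variable R : realType.
Local Notation C := R[i].

Lemma normc_ge_Im (z : C) : `|complex.Im z|%:C%C <= `|z|.
Proof. by rewrite normc_def lecR -sqrtr_sqr ler_sqrt ?lerDr ?addr_ge0 ?sqr_ge0. Qed.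

Lemma ge0_approx (g : C) :
  (forall e : C, 0 < e -> exists2 x : C, 0 <= x & `|g - x| <= e) -> 0 <= g.
Proof.
move=> gx.
have key (e : R) : 0 < e -> `|complex.Im g| <= e /\ - e <= complex.Re g.
  move=> e0; have [|x x0 gxe] := gx e%:C%C; first by rewrite ltcR.
  have Ix : complex.Im x = 0 by move: x0; rewrite lecE => /andP[/eqP].
  have Rx : 0 <= complex.Re x by move: x0; rewrite lecE => /andP[_].
  have := le_trans (normc_ge_Im _) gxe; have := le_trans (normc_ge_Re _) gxe.
  rewrite !lecR !raddfB /= Ix subr0 => Re_e Im_e; split=> //.
  by move: Re_e; rewrite ler_norml => /andP[+ _]; lra.
rewrite lecE; apply/andP; split.
  rewrite -normr_le0 leNgt; apply/negP => I0.
  have [|+ _] := key (`|complex.Im g| / 2); first by rewrite divr_gt0.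
  by move: I0; lra.
rewrite leNgt; apply/negP => R0; have [|_] := key (- complex.Re g / 2).
  by move: R0 => /=; lra.
by move: R0 => /=; lra.
Qed.

Lemma exists_halving (B e : C) : 0 <= B -> 0 < e ->
  exists2 D, (0 < D)%N & B * 2^-1 ^+ D <= e.
Proof.
move=> B0 e0.
have [b Bb] : exists b : R, B = b%:C%C.
  by exists (complex.Re B); rewrite RRe_real ?ger0_real.
have [r er] : exists r : R, e = r%:C%C.
  by exists (complex.Re e); rewrite RRe_real ?gtr0_real.
move: B0 e0; rewrite Bb er -[0]/(0%:C%C) lecR ltcR => b0 r0.
exists (Num.trunc (b / r)).+1 => //.
have lt : b / r < (Num.trunc (b / r)).+1%:R.
  by have := truncnS_gt (b / r).
set D := _.+1 in lt *.
rewrite exprVn ler_pdivrMr ?exprn_gt0//.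
have -> : (2 : C) ^+ D = (2 ^+ D)%:C%C by rewrite rmorphXn rmorph_nat.
rewrite -rmorphM lecR mulrC -ler_pdivrMr//.
apply: (le_trans (ltW lt)); rewrite -natrX ler_nat; exact/ltnW/ltn_expl.
Qed.

(** If the damped values of a convergent sequence of bipolynomials are
    asymptotically nonnegative for dampings of arbitrarily high order, then so is
    the limit of the values at $(1,1)$: the uniform bound makes the damping
    error uniform in the sequence, so that the two limits may be exchanged. *)
Lemma damped_limit_ge0 (d : nat -> nat) (c : nat -> nat -> nat -> C) (B g : C) :
  (\forall k \near \oo, forall s t : C, `|s| = 2 -> `|t| = 2 ->
    `|\sum_(i < d k) \sum_(j < d k) c k i j * s ^+ i * t ^+ j| <= B) ->
  (forall e : C, 0 < e -> \forall k \near \oo,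
    `|g - \sum_(i < d k) \sum_(j < d k) c k i j| <= e) ->
  (forall D, (0 < D)%N -> exists m : nat -> C,
    [/\ forall a, (a < D)%N -> m a = 1, forall a, 0 <= m a <= 1 &
      forall e : C, 0 < e -> \forall k \near \oo, exists2 x : C, 0 <= x &
        `|\sum_(i < d k) \sum_(j < d k) c k i j * m i * m j - x| <= e]) ->
  0 <= g.
Proof.
move=> cB cg cm; apply: ge0_approx => e e0.
have e3 : 0 < e / 3 by rewrite divr_gt0.
have B0 : 0 <= B.
  have [k _ /(_ k (leqnn k)) kB] := cB.
  by apply: le_trans (kB 2 2 (normr_nat _ _) (normr_nat _ _)).
have B8 : 0 <= 8 * B by rewrite mulr_ge0.
have [D D0 De] := exists_halving B8 e3.
have [m [m1 m01 mx]] := cm D D0.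
near \oo => k.
have [x x0 xe] : exists2 x : C, 0 <= x &
    `|\sum_(i < d k) \sum_(j < d k) c k i j * m i * m j - x| <= e / 3.
  by near: k; exact: mx.
exists x => //.
have kB : forall s t : C, `|s| = 2 -> `|t| = 2 ->
    `|\sum_(i < d k) \sum_(j < d k) c k i j * s ^+ i * t ^+ j| <= B.
  by near: k.
have kg : `|g - \sum_(i < d k) \sum_(j < d k) c k i j| <= e / 3.
  by near: k; exact: cg.
have err := le_trans (damping_error kB m1 m01) De.
have -> : e = e / 3 + e / 3 + e / 3 by field.
apply: le_trans (ler_distD (\sum_(i < d k) \sum_(j < d k) c k i j * m i * m j) _ _) _.
apply: lerD => //.
apply: le_trans (ler_distD (\sum_(i < d k) \sum_(j < d k) c k i j) _ _) _.
exact: lerD.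
Unshelve. all: by end_near. Qed.

End ComplexLimits.

(** * The enumeration of pairs of words *)

Section EnumerationOfPairs.
Variable N : nat.
Implicit Types (w : word N) (p : word N * word N).

Lemma uniq_flatten_graded (T : eqType) (deg : T -> nat) (f : nat -> seq T) s :
  uniq s -> (forall m, uniq (f m)) -> (forall m x, x \in f m -> deg x = m) ->
  uniq (flatten [seq f m | m <- s]).
Proof.
move=> + f_uniq f_deg; elim: s => //= m s IH /andP[ms /IH s_uniq].
rewrite cat_uniq f_uniq s_uniq andbT /=; apply/hasPn => x.
move=> /flattenP[_ /mapP[m' m's ->] /f_deg x_deg]; apply: contra ms => /f_deg.
by rewrite x_deg => <-.
Qed.

Lemma uniq_words m : uniq (words N m).
Proof.
elim: m => //= m IH; apply: allpairs_uniq => //; first exact: enum_uniq.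
by move=> [i v] [j w] _ _ /= [-> ->].
Qed.

Lemma uniq_pairs m : uniq (pairs N m).
Proof.
have := pairs_lexi N m; rewrite uniq_pairwise; apply: sub_pairwise => p q.
by apply: contraTneq => ->; rewrite ltxx.
Qed.

Lemma uniq_first_pairs k : uniq (first_pairs N k).
Proof.
apply/take_uniq/(uniq_flatten_graded (deg := fun p => size p.1 + size p.2)%N).
- exact: iota_uniq.
- exact: uniq_pairs.
- by move=> m p; rewrite mem_pairs => /eqP.
Qed.

Lemma mem_first_pairs D : \forall k \near \oo, forall p,
  (size p.1 < D)%N -> (size p.2 < D)%N -> p \in first_pairs N k.
Proof.
pose L := flatten [seq pairs N m | m <- iota 0 (D + D)].
(* Late enough for all lengths below [D + D] to be listed and not cut off. *)
exists (maxn (D + D) (size L)) => // k; rewrite /= geq_max => /andP[Dk Lk] p p1 p2.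
rewrite /first_pairs -(subnKC Dk) iotaD map_cat flatten_cat -/L subnKC//.
rewrite take_cat ltnNge Lk /= mem_cat; apply/orP; left.
apply/flattenP; exists (pairs N (size p.1 + size p.2)); last by rewrite mem_pairs.
by apply: map_f; rewrite mem_iota; move: p1 p2; clear; lia.
Qed.

Definition words_below D : seq (word N) := flatten [seq words N m | m <- iota 0 D].

Lemma mem_words_below D w : (w \in words_below D) = (size w < D)%N.
Proof.
apply/flattenP/idP => [[_ /mapP[m + ->]]|wD].
  by rewrite mem_iota mem_words => /andP[_ mD] /eqP ->.
exists (words N (size w)); last by rewrite mem_words.
by apply: map_f; rewrite mem_iota.
Qed.

Lemma uniq_words_below D : uniq (words_below D).
Proof.
apply: (uniq_flatten_graded (deg := size)); first exact: iota_uniq.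
- exact: uniq_words.
- by move=> m w; rewrite mem_words => /eqP.
Qed.

(** Positivity of the coefficients concerns sums over squares of words, whereas
    the enumeration is by total length; a cut-off of the factors turns a late
    partial sum into a square one. *)
Lemma sum_first_pairs_below D : \forall k \near \oo,
  forall (V : nmodType) (F : word N * word N -> V),
  \sum_(p <- first_pairs N k | (size p.1 < D)%N && (size p.2 < D)%N) F p
  = \sum_(w <- words_below D) \sum_(w' <- words_below D) F (w, w').
Proof.
apply: filterS (mem_first_pairs D) => k kD V F.
rewrite -big_filter; transitivity (\sum_(p <-
  [seq (w, w') | w <- words_below D, w' <- words_below D]) F p).
  2: by rewrite big_allpairs.
apply: perm_big; apply: uniq_perm.
- by rewrite filter_uniq// uniq_first_pairs.
- apply: allpairs_uniq; rewrite ?uniq_words_below//.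
  by move=> [? ?] [? ?] _ _.
move=> [w w']; rewrite mem_filter -andbA.
apply/and3P/allpairsPdep => [[/= wD w'D _]|[v [v' [+ + [-> ->]]]]].
  by exists w, w'; rewrite !mem_words_below.
by rewrite !mem_words_below => vD v'D; split => //; exact: kD.
Qed.

End EnumerationOfPairs.

(** * The kernel as a quadratic form in its coefficients *)

Section SesquilinearForms.
Variables (R : realType) (E : hilbertType R).
Local Notation C := R[i].
Local Notation conj := (@Num.conj C).

Lemma inner_le (u v : E) : `|inner u v| <= `|u| * `|v|.
Proof.
have := dot_CauchySchwarz inner u v.
by rewrite -!inner_normE !sqrCK.
Qed.

Lemma inner_sum (I J : Type) (r : seq I) (s : seq J) (u : I -> E) (v : J -> E) :
  inner (\sum_(i <- r) u i) (\sum_(j <- s) v j)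
  = \sum_(i <- r) \sum_(j <- s) inner (u i) (v j).
Proof.
rewrite linear_sumlz; apply: eq_bigr => i _; exact: linear_sumr.
Qed.

Lemma innerZ (a b : C) (u v : E) :
  inner (a *: u) (b *: v) = a * conj b * inner u v.
Proof. by rewrite (linearZl_LR inner)/= (linearZr_LR inner)/= mulrA. Qed.

Lemma bop_sum (V W : normedModType C) (I : Type) (r : seq I) (P : pred I)
  (f : I -> bop V W) x : (\sum_(i <- r | P i) f i) x = \sum_(i <- r | P i) f i x.
Proof. exact: (big_morph (fun g : bop V W => g x) (fun f g => bopD f g x) (erefl _)). Qed.

End SesquilinearForms.

Section Terms.
Variables (R : realType) (N : nat) (E : hilbertType R).
Local Notation C := R[i].
Local Notation conj := (@Num.conj C).
Local Notation mxtuple n := 'rV['M[C]_n]_N.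
Implicit Types (K : word N -> word N -> 'L(E)) (w : word N).

Lemma mxtuple_pow_cons n (Z : mxtuple n) j w :
  mxtuple_pow Z (j :: w) = Z 0 j *m mxtuple_pow Z w.
Proof. by rewrite /mxtuple_pow big_cons. Qed.

Lemma mxtuple_pow_adj n (Z : mxtuple n) w :
  mxtuple_pow (mxtuple_adj Z) (rev w) = (map_mx conj (mxtuple_pow Z w))^T.
Proof.
elim: w => [|j w IH].
  by rewrite /mxtuple_pow !big_nil map_mx1 trmx1.
rewrite rev_cons /mxtuple_pow -cats1 big_cat big_seq1 big_cons /=.
rewrite -[X in X * _]/(mxtuple_pow (mxtuple_adj Z) (rev w)) IH.
rewrite -!mulmxE map_mxM trmx_mul [mxtuple_adj _ _ _]mxE; congr (_ *m _).
by apply/matrixP => a b; rewrite !mxE.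
Qed.

(** The $b$-th component of $(Z^w)^*h$; moving $Z^w$ to the other side of the
    inner product turns the value of the kernel on a matrix tuple into values of
    the coefficient kernel. *)
Definition adj_pow_comp n (Z : mxtuple n) (h : tens E n) w (b : 'I_n) : E :=
  \sum_a conj (mxtuple_pow Z w a b) *: h a.

Lemma inner_nc_term_entries K n (Z Z' : mxtuple n) (p : word N * word N)
    (h h' : tens E n) :
  inner (nc_term K Z Z' p h') h
  = \sum_a \sum_c \sum_b mxtuple_pow Z p.1 a b * conj (mxtuple_pow Z' p.2 c b)
      * inner (K p.1 p.2 (h' c)) (h a).
Proof.
apply: eq_bigr => a _; rewrite /= mxtuple_pow_adj ffunE linear_sumlz.
apply: eq_bigr => c _; rewrite (linearZl_LR inner)/= mxE mulr_suml.
by apply: eq_bigr => b _; rewrite !mxE.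
Qed.

Lemma inner_nc_term K n (Z Z' : mxtuple n) (p : word N * word N) (h h' : tens E n) :
  inner (nc_term K Z Z' p h') h
  = \sum_b inner (K p.1 p.2 (adj_pow_comp Z' h' p.2 b)) (adj_pow_comp Z h p.1 b).
Proof.
rewrite inner_nc_term_entries.
under eq_bigr do rewrite exchange_big /=.
rewrite exchange_big /=; apply: eq_bigr => b _.
rewrite /adj_pow_comp (linear_sum (K p.1 p.2)) inner_sum exchange_big /=.
apply: eq_bigr => c _; apply: eq_bigr => a _.
by rewrite [X in _ = inner X _]linearZ innerZ conjCK [mxtuple_pow _ _ a b * _]mulrC.
Qed.

(** A combination of kernel values at several points is a quadratic form in the
    sums of the adjoint powers: this is how positivity is transported between the
    matrices and the coefficients. *)
Lemma sum_inner_nc_term K n (I : finType) (Z : I -> mxtuple n) (h : I -> tens E n)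
    (x := fun w b => \sum_j adj_pow_comp (Z j) (h j) w b) p :
  \sum_j \sum_k inner (nc_term K (Z j) (Z k) p (h k)) (h j)
  = \sum_b inner (K p.1 p.2 (x p.2 b)) (x p.1 b).
Proof.
transitivity (\sum_j \sum_b \sum_k inner
    (K p.1 p.2 (adj_pow_comp (Z k) (h k) p.2 b)) (adj_pow_comp (Z j) (h j) p.1 b)).
  apply: eq_bigr => j _; rewrite [RHS]exchange_big; apply: eq_bigr => k _.
  exact: inner_nc_term.
rewrite exchange_big /=; apply: eq_bigr => b _.
rewrite /x (linear_sum (K p.1 p.2)) inner_sum.
by rewrite exchange_big.
Qed.

Lemma sum_inner_psum K n (I : finType) k (Z Z' : I -> mxtuple n) (h : I -> tens E n) :
  \sum_i \sum_j inner (nc_psum K k (Z i) (Z' j) (h j)) (h i)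
  = \sum_(p <- first_pairs N k)
      \sum_i \sum_j inner (nc_term K (Z i) (Z' j) p (h j)) (h i).
Proof.
rewrite [RHS]exchange_big; apply: eq_bigr => i _; rewrite [RHS]exchange_big.
by apply: eq_bigr => j _; rewrite bop_sum linear_sumlz.
Qed.

Lemma positive_nc_kernel_sum K (W : seq (word N)) (x : word N -> E) :
  positive_nc_kernel K ->
  0 <= \sum_(w <- W) \sum_(w' <- W) inner (K w w' (x w')) (x w).
Proof.
move=> /(_ (size W) (fun j => nth [::] W j) (fun j => x (nth [::] W j)) (fun=> I)).
rewrite (big_nth [::]) big_mkord; under [in X in _ -> X]eq_bigr do
  rewrite (big_nth [::]) big_mkord.
by [].
Qed.

Lemma cvg_inner K (U : forall n, set (mxtuple n)) n (Z Z' : mxtuple n)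
    (h h' : tens E n) (e : C) :
  nc_convergent K U -> U n Z -> U n Z' -> 0 < e -> \forall k \near \oo,
  `|inner (nc_eval K Z Z' h') h - inner (nc_psum K k Z Z' h') h| <= e.
Proof.
move=> /nc_convergentP K_cvg UZ UZ' e0.
have M0 : 0 < `|h'| * `|h| + 1 by rewrite ltr_wpDl// mulr_ge0.
have ZU : [set (Z, Z')] `<=` U n `*` U n by move=> _ ->.
have eM0 : 0 < e / (`|h'| * `|h| + 1) by rewrite divr_gt0.
have := K_cvg n _ ZU (@compact_set1 _ (Z, Z')) _ eM0; apply: filterS => k.
move=> /(_ (Z, Z') erefl) /ltW.
rewrite -[X in `|X| <= _]/(nc_eval K Z Z' - nc_psum K k Z Z'); set D := _ - _ => De.
have -> : inner (nc_eval K Z Z' h') h - inner (nc_psum K k Z Z' h') h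
    = inner (D h') h by rewrite -linearBl.
apply: le_trans (inner_le _ _) _.
apply: le_trans (ler_wpM2r (normr_ge0 _) (ler_opnorm _ _)) _.
rewrite -bop_normE -mulrA; apply: le_trans (ler_wpM2r _ De) _.
  by rewrite mulr_ge0.
by rewrite mulrAC ler_pdivrMr// ler_wpM2l ?(ltW e0)// lerDl.
Qed.

Lemma cvg_sum_inner K (U : forall n, set (mxtuple n)) n (I : finType) (Z : I -> mxtuple n)
    (h : I -> tens E n) (e : C) :
  nc_convergent K U -> (forall j, U n (Z j)) -> 0 < e -> \forall k \near \oo,
  `|\sum_i \sum_j inner (nc_eval K (Z i) (Z j) (h j)) (h i)
    - \sum_i \sum_j inner (nc_psum K k (Z i) (Z j) (h j)) (h i)| <= e.
Proof.
move=> K_cvg UZ e0; have l0 : 0 < e / (#|I| * #|I|).+1%:R by rewrite divr_gt0 ?ltr0n.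
near=> k; rewrite -sumrB; under eq_bigr do rewrite -sumrB.
apply: (@le_trans _ _ (\sum_(i : I) \sum_(j : I) e / (#|I| * #|I|).+1%:R)).
  apply: le_trans (ler_norm_sum _ _ _) _; apply: ler_sum => i _.
  apply: le_trans (ler_norm_sum _ _ _) _; apply: ler_sum => j _.
  move: i j; near: k; apply: filter_forall => i; apply: filter_forall => j.
  exact: cvg_inner.
rewrite !sumr_const -mulrnA -[leLHS]mulr_natr -mulrA.
rewrite ler_piMr ?(ltW e0)//.
by rewrite mulrC ler_pdivrMr ?ltr0n// mul1r ler_nat.
Unshelve. all: by end_near. Qed.

End Terms.

(** * Neighbourhoods of tuples of matrices *)

Section EntrywiseBalls.
Variables (R : realType) (N n : nat).
Local Notation C := R[i].
Local Notation mxtuple := 'rV['M[C]_n]_N.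
Implicit Types (p Z : mxtuple).

Definition entry_ball p (r : C) : set mxtuple :=
  [set Z : mxtuple | forall j a b, `|Z 0 j a b - p 0 j a b| < r].

Lemma entry_ballE p (r : C) : 0 < r -> entry_ball p r = ball p r.
Proof.
move=> r0; apply/seteqP; split => Z.
  move=> pZ; split=> // i j; split=> // a b.
  by rewrite (ord1 i) -ball_normE /ball_ /= distrC; exact: pZ.
move=> [_ pZ] j a b; have [_ /(_ a b)] := pZ 0 j.
by rewrite -ball_normE /ball_ /= distrC.
Qed.

Lemma open_entry_ball (U : set mxtuple) p : open U -> U p ->
  exists2 r : C, 0 < r & entry_ball p r `<=` U.
Proof.
move=> Uo Up; have /nbhs_ballP[r r0 rU] := open_nbhs_nbhs (conj Uo Up).
by exists r => //; rewrite entry_ballE.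
Qed.

End EntrywiseBalls.

(** * Truncated creation operators *)

Section CreationOperators.
Variables (R : realType) (N : nat).
Local Notation C := R[i].
Local Notation conj := (@Num.conj C).
Local Notation mxtuple n := 'rV['M[C]_n]_N.
Variables (D : nat) (eps : C).
Implicit Types (w : word N).

Let n := size (words_below N D).
Local Notation wd := (nth [::] (words_below N D)).

Lemma size_wd (a : 'I_n) : (size (wd a) < D)%N.
Proof. by rewrite -mem_words_below mem_nth. Qed.

Lemma wd_inj (a b : 'I_n) : wd a = wd b -> a = b.
Proof.
by move=> /eqP; rewrite nth_uniq ?uniq_words_below// => /eqP /val_inj.
Qed.

Lemma wd_surj w : (size w < D)%N -> exists a : 'I_n, wd a = w.
Proof.
rewrite -mem_words_below => wD; exists (Ordinal (etrans (index_mem _ _) wD)).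
exact: nth_index.
Qed.

(** The matrices of the scaled left multiplications $u\mapsto g_ju$ on the span of
    the words of length below $D$. *)
Definition creation : mxtuple n :=
  \row_j \matrix_(a, b) if wd a == j :: wd b then eps else 0.

Lemma creation_pow w (a b : 'I_n) : mxtuple_pow creation w a b
  = if wd a == w ++ wd b then eps ^+ size w else 0.
Proof.
elim: w a => [|j w IH] a.
  rewrite /mxtuple_pow big_nil mxE; case: eqVneq => [->|ab]; first by rewrite eqxx.
  by case: eqVneq => // /wd_inj /eqP; rewrite (negbTE ab).
rewrite mxtuple_pow_cons mxE; under eq_bigr do rewrite IH !mxE.
have [wa|wa] := eqVneq (wd a) (j :: w ++ wd b).
  have [c wc] : exists c : 'I_n, wd c = w ++ wd b.
    by apply: wd_surj; have := size_wd a; rewrite wa => /ltnW.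
  rewrite (bigD1 c)//= wc eqxx wa eqxx exprS big1 ?addr0// => d dc.
  case: (eqVneq (wd d) _) => [wdd|]; last by rewrite mulr0.
  by case/eqP: dc; apply: wd_inj; rewrite wdd.
rewrite big1// => c _; have [wc|] := eqVneq (wd c) (w ++ wd b); last by rewrite mulr0.
by rewrite wc (negbTE wa) mul0r.
Qed.

(** The sign that singles out the empty word. *)
Definition vacuum_sign (a : 'I_n) : C := (-1) ^+ (wd a != [::]).

(** A second point, unitarily equivalent to the first: the sum over both points
    retains only the component at the empty word. *)
Definition creation_flip : mxtuple n :=
  \row_j \matrix_(a, b) (vacuum_sign a * vacuum_sign b * creation 0 j a b).

Lemma vacuum_sign2 a : vacuum_sign a * vacuum_sign a = 1.
Proof. by rewrite -expr2 sqrr_sign. Qed.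

Lemma creation_flip_pow w (a b : 'I_n) : mxtuple_pow creation_flip w a b
  = vacuum_sign a * vacuum_sign b * mxtuple_pow creation w a b.
Proof.
elim: w a => [|j w IH] a.
  rewrite /mxtuple_pow !big_nil mxE; case: eqVneq => [->|_]; last by rewrite mulr0.
  by rewrite vacuum_sign2 mulr1.
rewrite !mxtuple_pow_cons !mxE mulr_sumr; apply: eq_bigr => c _.
rewrite IH !mxE; set x := if _ then _ else _; set y := mxtuple_pow _ _ _ _.
by rewrite -[RHS]mul1r -(vacuum_sign2 c); ring.
Qed.

Lemma creation_entry (r : C) : 0 < eps < r -> entry_ball 0 r creation.
Proof.
move=> /andP[e0 er] j a b; rewrite !mxE subr0.
by case: ifP => _; rewrite ?normr0 ?(lt_trans e0)// gtr0_norm.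
Qed.

Lemma creation_flip_entry (r : C) : 0 < eps < r -> entry_ball 0 r creation_flip.
Proof.
move=> er j a b; have := creation_entry er j a b; rewrite !mxE !subr0.
by rewrite !normrM !normr_sign !mul1r.
Qed.

Variables (E : hilbertType R) (x : word N -> E).
Hypothesis eps_neq0 : eps != 0.

(** The conjugate powers of $\varepsilon$ compensate the scaling of the creation
    matrices, so that the vacuum component of $(Z^w)^*$ at this tensor is exactly
    $x_w$. *)
Definition creation_vec : tens E n :=
  [ffun a : 'I_n => (conj eps) ^- size (wd a) *: x (wd a)].

Definition creation_flip_vec : tens E n :=
  [ffun a : 'I_n => vacuum_sign a *: creation_vec a].

Lemma creation_flip_comp w b :
  adj_pow_comp creation_flip creation_flip_vec w b
  = vacuum_sign b *: adj_pow_comp creation creation_vec w b.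
Proof.
rewrite /adj_pow_comp scaler_sumr; apply: eq_bigr => a _.
have -> : conj (mxtuple_pow creation_flip w a b)
    = vacuum_sign a * vacuum_sign b * conj (mxtuple_pow creation w a b).
  by rewrite creation_flip_pow rmorphM /= rmorphM /= /vacuum_sign !rmorph_sign.
rewrite !ffunE !scalerA; congr (_ *: _); rewrite -[RHS]mul1r -(vacuum_sign2 a).
move: (conj _) (_ ^- _) (vacuum_sign a) (vacuum_sign b) => p q s t; ring.
Qed.

Lemma creation_comp w (b : 'I_n) : wd b = [::] ->
  adj_pow_comp creation creation_vec w b = if (size w < D)%N then x w else 0.
Proof.
move=> wb; rewrite /adj_pow_comp; case: ifPn => [wD|wD].
  have [a wa] := wd_surj wD; rewrite (bigD1 a)//= creation_pow wb cats0 wa eqxx.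
  rewrite ffunE wa scalerA rmorphXn mulfV ?expf_neq0 ?conjC_eq0// scale1r.
  rewrite big1 ?addr0// => c ca; rewrite creation_pow wb cats0.
  case: eqVneq => [wc|]; last by rewrite rmorph0 scale0r.
  by case/eqP: ca; apply: wd_inj; rewrite wc.
rewrite big1// => a _; rewrite creation_pow wb cats0.
case: eqVneq => [wa|]; last by rewrite rmorph0 scale0r.
by case/negP: wD; rewrite -wa size_wd.
Qed.

Lemma creation_comp_sum w (b : 'I_n) :
  adj_pow_comp creation creation_vec w b
    + adj_pow_comp creation_flip creation_flip_vec w b
  = if (wd b == [::]) && (size w < D)%N then 2 *: x w else 0.
Proof.
rewrite creation_flip_comp /vacuum_sign; case: eqVneq => [wb|_] /=.
  rewrite expr0 scale1r creation_comp//; case: ifP => _; last by rewrite addr0.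
  by rewrite scaler_nat.
by rewrite expr1 scaleN1r subrr.
Qed.

End CreationOperators.

(** * From positive values to positive coefficients *)

Section Necessity.
Variables (R : realType) (N : nat) (E : hilbertType R).
Local Notation C := R[i].
Local Notation mxtuple n := 'rV['M[C]_n]_N.

(** At the two tuples of creation matrices the series reduces to a finite sum over
    words of length below $D$, and the components away from the vacuum cancel. *)
Lemma nc_eval_ge0_words (K : word N -> word N -> 'L(E))
    (U : forall n, set (mxtuple n)) (D : nat) (x : word N -> E) :
  (forall n, open (U n)) -> (forall n, U n 0) -> nc_convergent K U ->
  (forall n, positive_kernel (U n) (nc_eval K (n := n))) -> (0 < D)%N ->
  0 <= \sum_(w <- words_below N D) \sum_(w' <- words_below N D)
         inner (K w w' (x w')) (x w).
Proof.
move=> U_open U_0 K_cvg K_pos D0.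
have [r r0 rU] := open_entry_ball (U_open (size (words_below N D))) (U_0 _).
pose eps := r / 2.
have e0 : 0 < eps by rewrite divr_gt0.
have er : 0 < eps < r by rewrite e0 /eps gtr_pMr// invf_lt1 ?ltr1n.
(* Two points, in order to isolate the component at the empty word. *)
pose Z (i : 'I_2) := if i == 0 then creation N D eps else creation_flip N D eps.
pose h (i : 'I_2) := if i == 0 then creation_vec D eps x else creation_flip_vec D eps x.
have UZ i : U _ (Z i).
  apply: rU; rewrite /Z; case: ifP => _; first exact: creation_entry.
  exact: creation_flip_entry.
set S := \sum_(_ <- _) _.
suff : 0 <= 4 * S by rewrite pmulr_rge0.
apply: ge0_approx => e egt0.
exists (\sum_i \sum_j inner (nc_eval K (Z i) (Z j) (h j)) (h i)).
  exact: K_pos.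
near \oo => k.
suff -> : 4 * S = \sum_i \sum_j inner (nc_psum K k (Z i) (Z j) (h j)) (h i).
  by rewrite distrC; near: k; exact: cvg_sum_inner.
rewrite sum_inner_psum; under [RHS]eq_bigr do rewrite sum_inner_nc_term.
have [b wb] : exists b : 'I_(size (words_below N D)), nth [::] (words_below N D) b = [::].
  exact: wd_surj.
pose y w := if (size w < D)%N then 2 *: x w else 0.
transitivity (\sum_(p <- first_pairs N k) inner (K p.1 p.2 (y p.2)) (y p.1)).
  transitivity (\sum_(p <- first_pairs N k | (size p.1 < D)%N && (size p.2 < D)%N)
      4 * inner (K p.1 p.2 (x p.2)) (x p.1)).
    have -> : \sum_(p <- first_pairs N k | (size p.1 < D)%N && (size p.2 < D)%N)
        4 * inner (K p.1 p.2 (x p.2)) (x p.1) =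
      \sum_(w <- words_below N D) \sum_(w' <- words_below N D)
         4 * inner (K w w' (x w')) (x w).
      by near: k; apply: filterS (sum_first_pairs_below N D) => k ->.
    by rewrite /S mulr_sumr; apply: eq_bigr => w _; rewrite mulr_sumr.
  rewrite big_mkcond /=; apply: eq_bigr => p _; rewrite /y.
  case: (size p.1 < D)%N; last by rewrite linear0r.
  case: (size p.2 < D)%N; last by rewrite linear0 linear0l.
  by rewrite [X in _ = inner X _]linearZ innerZ conjC_nat -natrM.
have comp w (c : 'I_(size (words_below N D))) :
    \sum_(j < 2) adj_pow_comp (Z j) (h j) w c = if c == b then y w else 0.
  rewrite !big_ord_recl big_ord0 addr0 /Z /h /= creation_comp_sum ?(gt_eqF e0)//.
  case: (eqVneq c b) => [->|cb]; first by rewrite wb eqxx.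
  case: eqP => // wc; case/eqP: cb; apply: wd_inj; rewrite wc; exact/esym.
apply: eq_bigr => p _; rewrite (bigD1 b)//= !comp eqxx.
rewrite [X in _ = _ + X]big1 ?addr0// => c cb.
by rewrite !comp (negbTE cb) linear0r.
Unshelve. all: by end_near. Qed.

(** A family of words may repeat a word; adding up the vectors attached to the
    same word turns it into a family indexed by all words of bounded length. *)
Lemma positive_nc_kernel_words (K : word N -> word N -> 'L(E)) :
  (forall D (x : word N -> E), (0 < D)%N ->
    0 <= \sum_(w <- words_below N D) \sum_(w' <- words_below N D)
           inner (K w w' (x w')) (x w)) ->
  positive_nc_kernel K.
Proof.
move=> Kx l om h _; pose D := (\max_j size (om j)).+1.
pose x w := \sum_(j | om j == w) h j.
have := Kx D x isT; congr (_ <= _).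
have omD j : om j \in words_below N D.
  by rewrite mem_words_below ltnS; exact: (leq_bigmax j).
have fiber (V : nmodType) (F : word N -> 'I_l -> V) :
  \sum_(w <- words_below N D) \sum_(j | om j == w) F w j = \sum_j F (om j) j.
  under eq_bigr do rewrite big_mkcond /=.
  rewrite exchange_big /=; apply: eq_bigr => j _.
  rewrite -big_mkcond -big_filter (_ : [seq _ <- _ | _] = [:: om j]) ?big_seq1//.
  rewrite (eq_filter (a2 := pred1 (om j))); last by move=> w; rewrite /= eq_sym.
  by rewrite filter_pred1_uniq ?uniq_words_below.
transitivity (\sum_(w <- words_below N D) \sum_(w' <- words_below N D)
    \sum_(j | om j == w) \sum_(k | om k == w') inner (K w w' (h k)) (h j)).
  apply: eq_bigr => w _; apply: eq_bigr => w' _; rewrite [RHS]exchange_big.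
  rewrite /x (linear_sum (K w w')) linear_sumlz.
  by apply: eq_bigr => k _; rewrite linear_sumr.
under eq_bigr do rewrite exchange_big /=.
rewrite fiber; apply: eq_bigr => j _.
by rewrite fiber.
Qed.

End Necessity.

(** * The partial sums along complex lines *)

Section Bipolynomials.
Variable C : numClosedFieldType.
Implicit Types f g : C -> C -> C.

(** The outer variable is the second argument. *)
Definition bipoly f := exists P : {poly {poly C}}, forall s t, f s t = P.[t%:P].[s].

Lemma bipoly_cst (a : C) : bipoly (fun _ _ => a).
Proof. by exists (a%:P)%:P => s t; rewrite !hornerC. Qed.

Lemma bipoly_fst : bipoly (fun s _ => s).
Proof. by exists ('X)%:P => s t; rewrite hornerC hornerX. Qed.

Lemma bipoly_snd : bipoly (fun _ t => t).
Proof. by exists 'X => s t; rewrite hornerX hornerC. Qed.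

Lemma bipolyD f g : bipoly f -> bipoly g -> bipoly (fun s t => f s t + g s t).
Proof.
by move=> [P fP] [Q gQ]; exists (P + Q) => s t; rewrite fP gQ !hornerD.
Qed.

Lemma bipolyM f g : bipoly f -> bipoly g -> bipoly (fun s t => f s t * g s t).
Proof.
by move=> [P fP] [Q gQ]; exists (P * Q) => s t; rewrite fP gQ !hornerM.
Qed.

Lemma bipoly_sum (I : Type) (r : seq I) (f : I -> C -> C -> C) :
  (forall i, bipoly (f i)) -> bipoly (fun s t => \sum_(i <- r) f i s t).
Proof.
move=> f_poly; elim: r => [|i r IH].
  by have [P HP] := bipoly_cst 0; exists P => s t; rewrite big_nil -HP.
have [P HP] := bipolyD (f_poly i) IH.
by exists P => s t; rewrite big_cons -HP.
Qed.

Lemma bipoly_coef f : bipoly f -> exists d (c : nat -> nat -> C), forall s t,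
  f s t = \sum_(a < d) \sum_(b < d) c a b * s ^+ a * t ^+ b.
Proof.
move=> [P fP]; pose d := maxn (size P) (\max_(b < size P) size (P`_b)%R).
exists d, (fun a b => P`_b`_a) => s t.
rewrite fP (@horner_coef_wide _ d P) ?leq_maxl// horner_sum exchange_big.
apply: eq_bigr => b _; rewrite -rmorphXn /= hornerM hornerC.
rewrite (@horner_coef_wide _ d) ?mulr_suml//.
have [bP|bP] := ltnP b (size P); last by rewrite nth_default// size_poly0.
apply: leq_trans (leq_maxr _ _).
exact: (@leq_bigmax _ (fun b : 'I_(size P) => size (P`_b)%R) (Ordinal bP)).
Qed.

Lemma bipoly_bounded f (r : C) : bipoly f -> exists B, forall s t,
  `|s| <= r -> `|t| <= r -> `|f s t| <= B.
Proof.
move=> /bipoly_coef[d [c fc]].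
exists (\sum_(a < d) \sum_(b < d) `|c a b| * r ^+ a * r ^+ b) => s t sr tr.
have r0 : 0 <= r by exact: le_trans sr.
rewrite fc; apply: le_trans (ler_norm_sum _ _ _) _; apply: ler_sum => a _.
apply: le_trans (ler_norm_sum _ _ _) _; apply: ler_sum => b _.
rewrite !normrM !normrX; apply: ler_pM => //; rewrite ?mulr_ge0 ?exprn_ge0//.
  by apply: ler_wpM2l => //; apply: lerXn2r; rewrite ?nnegrE.
by apply: lerXn2r; rewrite ?nnegrE.
Qed.

(** Averaging a bipolynomial with the same weights in both variables multiplies
    its coefficients by the moments. *)
Lemma bipoly_average (I : finType) (u s : I -> C) (m : nat -> C)
    (c : nat -> nat -> C) d :
  (forall a, \sum_i u i * s i ^+ a = m a) -> (forall a, 0 <= m a) ->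
  \sum_(a < d) \sum_(b < d) c a b * m a * m b
  = \sum_i \sum_j u i * (u j)^* *
      \sum_(a < d) \sum_(b < d) c a b * s i ^+ a * (s j)^* ^+ b.
Proof.
move=> um m0.
have um' a : \sum_i (u i)^* * (s i)^* ^+ a = m a.
  rewrite -(geC0_conj (m0 a)) -um rmorph_sum; apply: eq_bigr => i _.
  by rewrite rmorphM rmorphXn.
transitivity (\sum_(a < d) \sum_(b < d) \sum_i \sum_j
    u i * (u j)^* * (c a b * s i ^+ a * (s j)^* ^+ b)).
  apply: eq_bigr => a _; apply: eq_bigr => b _.
  rewrite -um -(um' b) -mulrA mulr_suml mulr_sumr; apply: eq_bigr => i _.
  by rewrite !mulr_sumr; apply: eq_bigr => j _; ring.
under eq_bigr do rewrite exchange_big /=; rewrite exchange_big /=.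
apply: eq_bigr => i _; under eq_bigr do rewrite exchange_big /=.
rewrite exchange_big /=; apply: eq_bigr => j _; rewrite mulr_sumr.
by apply: eq_bigr => a _; rewrite mulr_sumr.
Qed.

End Bipolynomials.

Section AffineLines.
Variables (R : realType) (N n : nat).
Local Notation C := R[i].
Local Notation conj := (@Num.conj C).
Local Notation mxtuple := 'rV['M[C]_n]_N.
Implicit Types (p v : mxtuple) (w : word N).

Definition affine_line p v (s : C) : mxtuple := \row_j (p 0 j + s *: v 0 j).

Lemma affine_lineE p v s j a b :
  affine_line p v s 0 j a b = p 0 j a b + s * v 0 j a b.
Proof. by rewrite !mxE. Qed.

Lemma bipoly_line_pow p v w a b :
  bipoly (fun s _ : C => mxtuple_pow (affine_line p v s) w a b).
Proof.
elim: w a => [|j w IH] a.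
  rewrite (_ : (fun s _ => _) = fun _ _ => (1%:M : 'M[C]_n) a b); first exact: bipoly_cst.
  by apply/funext => s; apply/funext => t; rewrite /mxtuple_pow big_nil.
rewrite (_ : (fun s _ => _) = fun s t : C => \sum_c
    (p 0 j a c + s * v 0 j a c) * mxtuple_pow (affine_line p v s) w c b).
  apply: bipoly_sum => c; apply: bipolyM => //; apply: bipolyD.
    exact: bipoly_cst.
  by apply: bipolyM; [exact: bipoly_fst | exact: bipoly_cst].
apply/funext => s; apply/funext => t; rewrite mxtuple_pow_cons mxE.
by apply: eq_bigr => c _; rewrite affine_lineE.
Qed.

(** The kernel is antiholomorphic in its second point; the conjugate parameter
    makes it polynomial. *)
Lemma bipoly_line_pow_conj p v w a b :
  bipoly (fun _ t : C => conj (mxtuple_pow (affine_line p v (conj t)) w a b)).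
Proof.
elim: w a => [|j w IH] a.
  rewrite (_ : (fun _ t => _) = fun _ _ => conj ((1%:M : 'M[C]_n) a b)).
    exact: bipoly_cst.
  by apply/funext => s; apply/funext => t; rewrite /mxtuple_pow big_nil.
rewrite (_ : (fun _ t => _) = fun s t : C => \sum_c
    (conj (p 0 j a c) + t * conj (v 0 j a c)) *
    conj (mxtuple_pow (affine_line p v (conj t)) w c b)).
  apply: bipoly_sum => c; apply: bipolyM => //; apply: bipolyD.
    exact: bipoly_cst.
  by apply: bipolyM; [exact: bipoly_snd | exact: bipoly_cst].
apply/funext => s; apply/funext => t; rewrite mxtuple_pow_cons mxE rmorph_sum.
apply: eq_bigr => c _.
by rewrite affine_lineE rmorphM rmorphD; congr ((_ + _) * _); rewrite rmorphM /= conjCK.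
Qed.

Lemma affine_line_continuous p v :
  continuous (fun x : R * R => affine_line p v (x.1 +i* x.2)%C).
Proof.
move=> x A /= /nbhs_ballP[r r0 rA].
pose V : C := \sum_j \sum_a \sum_b `|v 0 j a b|.
have V0 : 0 <= V by do 3 apply: sumr_ge0 => ? _.
have vV j a b : `|v 0 j a b| <= V.
  rewrite /V (bigD1 j)//= (bigD1 a)//= (bigD1 b)//= -!addrA lerDl.
  by rewrite !addr_ge0//; do ?[apply: sumr_ge0 => ? _].
have [e e0 eV] : exists2 e : R, 0 < e & (e + e)%:C%C * V < r.
  pose q := r / (2 * (V + 1)).
  have q0 : 0 < q by rewrite divr_gt0// mulr_gt0// ltr_wpDl.
  exists (complex.Re q); first by rewrite -ltcR RRe_real ?gtr0_real.
  rewrite rmorphD /= RRe_real ?gtr0_real// -mulr2n -mulr_natl.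
  rewrite (_ : 2 * q = r / (V + 1)); last first.
    by rewrite /q; field; rewrite lt0r_neq0// ltr_wpDl.
  by rewrite mulrAC ltr_pdivrMr ?ltr_wpDl// ltr_pM2l// ltrDl.
exists (ball x.1 e, ball x.2 e) => /=; first by split; exact: nbhsx_ballx.
move=> [y1 y2] /= [xy1 xy2]; apply: rA => /=.
suff yx : entry_ball (affine_line p v (x.1 +i* x.2)%C) r
    (affine_line p v (y1 +i* y2)%C) by rewrite -entry_ballE.
move=> j a b; rewrite (affine_lineE p v (x.1 +i* x.2)%C).
rewrite (affine_lineE p v (y1 +i* y2)%C) opprD addrACA subrr add0r -mulrBl normrM.
apply: le_lt_trans eV; apply: ler_pM => //.
move: xy1 xy2; rewrite -!ball_normE /ball_ /= distrC (distrC x.2) => xy1 xy2.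
have -> : (y1 +i* y2 - x.1 +i* x.2)%C = (y1 - x.1)%:C%C + 'i%C * (y2 - x.2)%:C%C.
  by simpc.
apply: le_trans (ler_normD _ _) _; rewrite normrM.
rewrite !normc_def /= expr0n /= add0r expr1n sqrtr1 mul1r !addr0 !sqrtr_sqr.
by rewrite rmorphD; apply: lerD; rewrite lecR ltW.
Qed.

Lemma compact_affine_line p v (r : R) : compact
  [set affine_line p v (x.1 +i* x.2)%C | x in `[- r, r] `*` `[- r, r]].
Proof.
apply: continuous_compact.
  exact/continuous_subspaceT/affine_line_continuous.
by apply: compact_setX; exact: segment_compact.
Qed.

End AffineLines.

(** * Positivity near the origin and its continuation *)

Lemma sum_swap_pair (V : nmodType) (I A : finType) (F : I * A -> V) :
  \sum_x F x = \sum_a \sum_i F (i, a).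
Proof.
rewrite exchange_big (pair_bigA _ (fun i a => F (i, a))).
by apply: eq_bigr => -[].
Qed.

Section AlongLines.
Variables (R : realType) (N : nat) (E : hilbertType R).
Local Notation C := R[i].
Local Notation conj := (@Num.conj C).
Local Notation mxtuple n := 'rV['M[C]_n]_N.
Variables (K : word N -> word N -> 'L(E)) (U : forall n, set (mxtuple n)).
Arguments U : clear implicits.
Hypothesis K_cvg : nc_convergent K U.
Variable n : nat.
Implicit Types (p v Z : mxtuple n) (h : tens E n).

Lemma bipoly_inner_psum p v p' v' h h' k : bipoly (fun s t : C =>
  inner (nc_psum K k (affine_line p v s) (affine_line p' v' (conj t)) h') h).
Proof.
rewrite (_ : (fun s t => _) = fun s t : C => \sum_(q <- first_pairs N k)
    inner (nc_term K (affine_line p v s) (affine_line p' v' (conj t)) q h') h); last first.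
  apply/funext => s; apply/funext => t.
  by rewrite [nc_psum _ _ _ _ _]bop_sum linear_sumlz.
apply: bipoly_sum => q.
rewrite (_ : (fun s t => _) = fun s t : C => \sum_a \sum_c \sum_b
    mxtuple_pow (affine_line p v s) q.1 a b *
    conj (mxtuple_pow (affine_line p' v' (conj t)) q.2 c b) *
    inner (K q.1 q.2 (h' c)) (h a)); last first.
  by apply/funext => s; apply/funext => t; rewrite inner_nc_term_entries.
do 3 apply: bipoly_sum => ?.
apply: bipolyM; last exact: bipoly_cst.
by apply: bipolyM; [exact: bipoly_line_pow | exact: bipoly_line_pow_conj].
Qed.

(** Uniform convergence on the compact image of a square makes the partial sums
    uniformly close to a single one of them, which is a bipolynomial. *)
Lemma psum_line_bounded p v p' v' h h' :
  (forall s : C, `|s| <= 4 -> U n (affine_line p v s)) ->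
  (forall s : C, `|s| <= 4 -> U n (affine_line p' v' s)) ->
  exists B : C, \forall k \near \oo, forall s t : C, `|s| = 2 -> `|t| = 2 ->
    `|inner (nc_psum K k (affine_line p v s) (affine_line p' v' (conj t)) h') h| <= B.
Proof.
(* The square contains the disc of radius 2 and lies in the disc of radius 4. *)
move=> Up Up'; pose sq : set (R * R) := `[- 2, 2] `*` `[- 2, 2].
pose L p v := [set affine_line p v (x.1 +i* x.2)%C | x in sq].
have L_sub q u : (forall s : C, `|s| <= 4 -> U n (affine_line q u s)) -> L q u `<=` U n.
  move=> Uq _ [[x y] [/= x2 y2] <-]; apply: Uq.
  rewrite normc_def /= -(rmorph_nat (real_complex R) 4) lecR.
  rewrite -(ger0_norm (ler0n R 4)) -sqrtr_sqr ler_sqrt ?sqr_ge0//.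
  move: x2 y2; rewrite !in_itv /= => /andP[x0 x1] /andP[y0 y1]; nra.
have L_mem q u (s : C) : `|s| = 2 -> L q u (affine_line q u s).
  move=> s2; exists (complex.Re s, complex.Im s); last by case: (s).
  have := normc_ge_Re s; have := normc_ge_Im s.
  rewrite s2 -(rmorph_nat (real_complex R) 2) !lecR !ler_norml => Im2 Re2.
  by split; rewrite /= in_itv.
have LU : L p v `*` L p' v' `<=` U n `*` U n.
  by move=> ZZ [/L_sub ? /L_sub ?]; split => /=; auto.
have Lc : compact (L p v `*` L p' v').
  by apply: compact_setX; exact: compact_affine_line.
have [k0 _ k0P] := (proj1 (nc_convergentP K U) K_cvg) n _ LU Lc 1 ltr01.
have [B BP] := bipoly_bounded 2 (bipoly_inner_psum p v p' v' h h' k0).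
exists (2 * `|h'| * `|h| + B), k0 => // k /= k0k s t s2 t2.
have st : (L p v `*` L p' v') (affine_line p v s, affine_line p' v' (conj t)).
  by split; apply: L_mem; rewrite ?norm_conjC.
have := ltW (k0P k k0k _ st); have := ltW (k0P k0 (leqnn _) _ st).
rewrite /fst /snd; set Z := affine_line p v s; set Z' := affine_line p' v' _.
move=> De0 De.
rewrite -[X in inner X _](subrK (nc_psum K k0 Z Z' h')) linearDl.
apply: le_trans (ler_normD _ _) _; apply: lerD; last first.
  by apply: BP; rewrite ?s2 ?t2.
apply: le_trans (inner_le _ _) _; apply: ler_wpM2r => //.
rewrite -[X in `|X|]/((nc_psum K k Z Z' - nc_psum K k0 Z Z') h').
apply: le_trans (ler_opnorm _ _) _; apply: ler_wpM2r => //.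
rewrite -bop_normE.
apply: le_trans (ler_distD (nc_eval K Z Z') _ _) _.
by rewrite distrC; exact: lerD De De0.
Qed.

Lemma psum_lines_bounded (I : finType) (p v : I -> mxtuple n) (h : I -> tens E n) :
  (forall i (s : C), `|s| <= 4 -> U n (affine_line (p i) (v i) s)) ->
  exists B : C, \forall k \near \oo, forall s t : C, `|s| = 2 -> `|t| = 2 ->
    `|\sum_i \sum_j inner (nc_psum K k (affine_line (p i) (v i) s)
        (affine_line (p j) (v j) (conj t)) (h j)) (h i)| <= B.
Proof.
move=> Upv.
have /choice[B BP] (x : I * I) : exists B : C, \forall k \near \oo,
    forall s t : C, `|s| = 2 -> `|t| = 2 ->
    `|inner (nc_psum K k (affine_line (p x.1) (v x.1) s)
        (affine_line (p x.2) (v x.2) (conj t)) (h x.2)) (h x.1)| <= B.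
  by apply: psum_line_bounded; exact: Upv.
exists (\sum_i \sum_j B (i, j)); near=> k => s t s2 t2.
have kB : forall (x : I * I) (s t : C), `|s| = 2 -> `|t| = 2 ->
    `|inner (nc_psum K k (affine_line (p x.1) (v x.1) s)
        (affine_line (p x.2) (v x.2) (conj t)) (h x.2)) (h x.1)| <= B x.
  by near: k; apply: filter_forall => x; exact: BP.
apply: le_trans (ler_norm_sum _ _ _) _; apply: ler_sum => i _.
apply: le_trans (ler_norm_sum _ _ _) _; apply: ler_sum => j _.
exact: (kB (i, j)).
Unshelve. all: by end_near. Qed.

Lemma positive_kernel_finType (Om : set (mxtuple n)) (I : finType)
    (Z : I -> mxtuple n) (h : I -> tens E n) :
  positive_kernel Om (nc_eval K (n := n)) -> (forall i, Om (Z i)) ->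
  0 <= \sum_i \sum_j inner (nc_eval K (Z i) (Z j) (h j)) (h i).
Proof.
move=> /(_ #|I| (fun i => Z (enum_val i)) (fun i => h (enum_val i))) K_pos OmZ.
apply: le_trans (K_pos _) _; first by move=> i; exact: OmZ.
rewrite le_eqVlt; apply/orP; left; apply/eqP; symmetry.
rewrite (reindex _ (onW_bij _ (enum_val_bij I))).
by apply: eq_bigr => i _; rewrite (reindex _ (onW_bij _ (enum_val_bij I))).
Qed.

Lemma line0_pow Z w (s : C) :
  mxtuple_pow (affine_line 0 Z s) w = s ^+ size w *: mxtuple_pow Z w.
Proof.
elim: w => [|j w IH]; first by rewrite /mxtuple_pow !big_nil scale1r.
rewrite !mxtuple_pow_cons IH /= exprS -scalerA -scalemxAr.
have -> : affine_line 0 Z s 0 j = s *: Z 0 j by rewrite mxE mxE add0r.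
by rewrite -scalemxAl !scalerA mulrC.
Qed.

Lemma inner_nc_term_line0 Z Z' h h' (q : word N * word N) (s t : C) :
  inner (nc_term K (affine_line 0 Z s) (affine_line 0 Z' (conj t)) q h') h
  = inner (nc_term K Z Z' q h') h * s ^+ size q.1 * t ^+ size q.2.
Proof.
rewrite !inner_nc_term_entries !mulr_suml; apply: eq_bigr => a _.
rewrite !mulr_suml; apply: eq_bigr => c _.
rewrite !mulr_suml; apply: eq_bigr => b _.
have -> : conj (mxtuple_pow (affine_line 0 Z' (conj t)) q.2 c b)
    = t ^+ size q.2 * conj (mxtuple_pow Z' q.2 c b).
  by rewrite line0_pow mxE rmorphM rmorphXn /= conjCK.
rewrite line0_pow mxE.
move: (mxtuple_pow _ _ _ _) (conj _) (inner _ _) (s ^+ _) (t ^+ _) => x y z u v.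
ring.
Qed.

(** Near the origin the points may be scaled up without leaving the domain of
    convergence, so the bihomogeneous components of the kernel decay
    geometrically, and the truncations that keep the words of length below $D$ in
    both factors approximate the kernel; they are positive because the
    coefficients are. *)
Lemma positive_kernel_near0 (r : C) :
  positive_nc_kernel K -> 0 < r -> entry_ball 0 (4 * r) `<=` U n ->
  positive_kernel (entry_ball 0 r) (nc_eval K (n := n)).
Proof.
move=> K_pos r0 rU l Z h Zr.
have lineU i (s : C) : `|s| <= 4 -> U n (affine_line 0 (Z i) s).
  move=> s4; apply: rU => j a b; rewrite affine_lineE addrC addKr normrM.
  have := Zr i j a b; rewrite mxE [X in _ - X]mxE subr0 => Zr'.
  by apply: le_lt_trans (ler_wpM2r (normr_ge0 _) s4) _; rewrite ltr_pM2l.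
have line1 i : affine_line 0 (Z i) 1 = Z i.
  by apply/matrixP => i0 j; rewrite (ord1 i0) !mxE add0r scale1r.
pose q (x : word N * word N) := \sum_i \sum_j inner (nc_term K (Z i) (Z j) x (h j)) (h i).
(* A bound on the degrees of the [k]-th partial sum. *)
pose d k := (\sum_(x <- first_pairs N k) (size x.1 + size x.2)).+1.
pose c k a b := \sum_(x <- first_pairs N k | (size x.1 == a) && (size x.2 == b)) q x.
have sum_c k (F G : nat -> C) : \sum_(a < d k) \sum_(b < d k) c k a b * F a * G b
    = \sum_(x <- first_pairs N k) q x * F (size x.1) * G (size x.2).
  have -> : \sum_(a < d k) \sum_(b < d k) c k a b * F a * G b
      = \sum_(a < d k) \sum_(b < d k) \sum_(x <- first_pairs N k)
         if (size x.1 == a) && (size x.2 == b) then q x * F a * G b else 0.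
    apply: eq_bigr => a _; apply: eq_bigr => b _; rewrite -big_mkcond /= -mulrA.
    by rewrite mulr_suml; apply: eq_bigr => x _; rewrite mulrA.
  under eq_bigr do rewrite exchange_big /=.
  rewrite exchange_big /=; apply: eq_big_seq => x xk.
  have xd : (size x.1 + size x.2 < d k)%N.
    by rewrite ltnS (big_rem x xk) /= leq_addr.
  rewrite (bigD1 (Ordinal (leq_ltn_trans (leq_addr _ _) xd)))//=.
  rewrite (bigD1 (Ordinal (leq_ltn_trans (leq_addl _ _) xd)))//= !eqxx /=.
  rewrite !big1 ?addr0// => [a ax|b bx].
    apply: big1 => b _; case: ifP => // /andP[/eqP xa _].
    by case/eqP: ax; apply/val_inj; rewrite /= xa.
  by case: ifP => // /eqP xb; case/eqP: bx; apply/val_inj; rewrite /= xb.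
have psum_c k (s t : C) : \sum_(a < d k) \sum_(b < d k) c k a b * s ^+ a * t ^+ b
    = \sum_i \sum_j inner (nc_psum K k (affine_line 0 (Z i) s)
        (affine_line 0 (Z j) (conj t)) (h j)) (h i).
  apply: etrans (sum_c k (fun a => s ^+ a) (fun b => t ^+ b)) _.
  apply/esym/(etrans (sum_inner_psum K k _ _ h))/esym.
  apply: eq_bigr => x _; rewrite /q !mulr_suml; apply: eq_bigr => i _.
  rewrite !mulr_suml; apply: eq_bigr => j _.
  by rewrite inner_nc_term_line0.
have [B BP] := psum_lines_bounded (I := 'I_l) h lineU.
apply: (damped_limit_ge0 (d := d) (c := c) (B := B)).
- by apply: filterS BP => k kB s t s2 t2; rewrite psum_c kB.
- move=> e e0; have := cvg_sum_inner h K_cvg _ e0.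
  move=> /(_ Z); have UZ i : U n (Z i).
    by rewrite -line1; apply: lineU; rewrite normr1 ler1n.
  move=> /(_ UZ); apply: filterS => k; congr (`|_ - _| <= _).
  have := psum_c k 1 1; rewrite conjC1.
  under eq_bigr do under eq_bigr do rewrite !expr1n !mulr1.
  move=> ->; apply: eq_bigr => i _; apply: eq_bigr => j _.
  by rewrite !line1.
(* The damping that cuts off at length [D] in each factor separately. *)
- move=> D D0; exists (fun a => (a < D)%N%:R); split=> [a ->//|a|e e0].
    by rewrite ler0n lern1 leq_b1.
  apply: filterS (sum_first_pairs_below N D) => k kD.
  exists (\sum_(w <- words_below N D) \sum_(w' <- words_below N D) q (w, w')).
    pose x w b := \sum_j adj_pow_comp (Z j) (h j) w b.
    have -> : \sum_(w <- words_below N D) \sum_(w' <- words_below N D) q (w, w')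
      = \sum_b \sum_(w <- words_below N D) \sum_(w' <- words_below N D)
          inner (K w w' (x w' b)) (x w b).
      rewrite [RHS]exchange_big; apply: eq_bigr => w _.
      rewrite [RHS]exchange_big; apply: eq_bigr => w' _.
      by rewrite /q sum_inner_nc_term.
    by apply: sumr_ge0 => b _; exact: (positive_nc_kernel_sum _ (x^~ b)).
  rewrite (sum_c k (fun a => (a < D)%N%:R) (fun a => (a < D)%N%:R)) -kD.
  rewrite [X in _ - X]big_mkcond -sumrB big1 ?normr0 ?(ltW e0)// => y _ /=.
  case: (size y.1 < D)%N; case: (size y.2 < D)%N => /=;
    by rewrite ?mulr1 ?mulr0 ?mul0r subrr.
Qed.

(** Each new point is the end of a complex line through $p$. Along these lines the
    kernel is positive at all small parameters, hence so are its averages there;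
    extrapolated from small circles to the parameter $1$, these averages
    approximate the kernel at the new points. *)
Lemma positive_kernel_extend (Om : set (mxtuple n)) p (r : C) :
  open Om -> Om `<=` U n -> positive_kernel Om (nc_eval K (n := n)) ->
  Om p -> 0 < r -> entry_ball p (4 * r) `<=` U n ->
  positive_kernel (Om `|` entry_ball p r) (nc_eval K (n := n)).
Proof.
move=> Om_open OmU Om_pos Omp r0 rU l Z h ZOm.
have [r1 r10 r1Om] := open_entry_ball Om_open Omp.
(* At parameters of modulus [e] the lines through [p] stay within [r1] of it. *)
pose e : C := r1 / (r1 + r).
have e0 : 0 < e by rewrite divr_gt0// addr_gt0.
have e1 : 0 < e <= 1 by rewrite e0 ler_pdivrMr ?addr_gt0// mul1r lerDl ltW.
have er : e * r < r1.
  by rewrite mulrAC ltr_pdivrMr ?addr_gt0// ltr_pM2l// ltrDr.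
have /choice[pv pvP] i : exists pv : mxtuple n * mxtuple n,
    [/\ affine_line pv.1 pv.2 1 = Z i,
        forall s : C, `|s| <= 4 -> U n (affine_line pv.1 pv.2 s) &
        forall s : C, `|s| = e -> Om (affine_line pv.1 pv.2 s)].
  (* A point of [Om] is joined to itself by a constant line. *)
  have [ZiOm|Zir] := ZOm i.
    have cst s : affine_line (Z i) 0 s = Z i.
      by apply/matrixP => i0 j; rewrite (ord1 i0) !mxE scaler0 addr0.
    by exists (Z i, 0); split => [|s _|s _] /=; rewrite cst//; exact: OmU.
  exists (p, Z i - p); split => /= [|s s4|s se].
  - by apply/matrixP => i0 j; rewrite (ord1 i0) !mxE scale1r addrCA subrr addr0.
  - apply: rU => j a b; rewrite affine_lineE addrC addKr normrM.
    rewrite !mxE; have Zr := Zir j a b.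
    by apply: le_lt_trans (ler_wpM2r (normr_ge0 _) s4) _; rewrite ltr_pM2l.
  - apply: r1Om => j a b; rewrite affine_lineE addrC addKr normrM.
    rewrite !mxE se; have Zr := Zir j a b.
    by apply: lt_trans er; rewrite ltr_pM2l.
pose ln i := affine_line (pv i).1 (pv i).2.
have ln1 i : ln i 1 = Z i by have [] := pvP i.
have lnU i (s : C) : `|s| <= 4 -> U n (ln i s) by have [_ + _] := pvP i; exact.
have lnOm i (s : C) : `|s| = e -> Om (ln i s) by have [_ _ +] := pvP i; exact.
pose Q k (s t : C) := \sum_i \sum_j
  inner (nc_psum K k (ln i s) (ln j (conj t)) (h j)) (h i).
have /choice[d /choice[c QE]] k : exists d (c : nat -> nat -> C), forall s t,
    Q k s t = \sum_(a < d) \sum_(b < d) c a b * s ^+ a * t ^+ b.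
  apply: bipoly_coef; apply: bipoly_sum => i; apply: bipoly_sum => j.
  exact: bipoly_inner_psum.
have [B BP] := psum_lines_bounded (I := 'I_l) h lnU.
apply: (damped_limit_ge0 (d := d) (c := c) (B := B)).
- by apply: filterS BP => k kB s t s2 t2; rewrite -QE kB.
- move=> x x0.
  have UZ i : U n (Z i) by rewrite -ln1; apply: lnU; rewrite normr1 ler1n.
  have := cvg_sum_inner h K_cvg UZ x0; apply: filterS => k; congr (`|_ - _| <= _).
  have := QE k 1 1; under eq_bigr do under eq_bigr do rewrite !expr1n !mulr1.
  move=> <-; apply: eq_bigr => i _; apply: eq_bigr => j _.
  by rewrite conjC1 !ln1.
(* Averaging the kernel along the lines is evaluating it at the finitely many
   points [Y] of [Om], with the weights absorbed into the vectors. *)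
- move=> D D0; have [u [s [m [se um m1 m01]]]] := extrapolation_nodes D0 e1.
  exists m; split => // x x0.
  pose Y (ia : 'I_l * 'I_D) := ln ia.1 (s ia.2).
  pose g (ia : 'I_l * 'I_D) := conj (u ia.2) *: h ia.1.
  have YOm ia : Om (Y ia) by exact: lnOm.
  have YU ia : U n (Y ia) by exact/OmU/YOm.
  have := cvg_sum_inner g K_cvg YU x0; apply: filterS => k kx.
  exists (\sum_ia \sum_jb inner (nc_eval K (Y ia) (Y jb) (g jb)) (g ia)).
    exact: positive_kernel_finType Om_pos YOm.
  rewrite distrC; apply: le_trans kx; rewrite le_eqVlt; apply/orP; left; apply/eqP.
  congr (`|_ - _|).
  rewrite (bipoly_average _ _ um); last by move=> a; have /andP[] := m01 a.
  under eq_bigr do under eq_bigr do rewrite -QE.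
  transitivity (\sum_a \sum_b \sum_i \sum_j
     inner (nc_psum K k (Y (i, a)) (Y (j, b)) (g (j, b))) (g (i, a))).
    apply: eq_bigr => a _; apply: eq_bigr => b _; rewrite mulr_sumr.
    apply: eq_bigr => i _; rewrite mulr_sumr; apply: eq_bigr => j _.
    rewrite /g conjCK [X in _ = inner X _]linearZ innerZ conjCK.
    by rewrite [u a * _]mulrC.
  rewrite [RHS]sum_swap_pair; apply: eq_bigr => a _; rewrite [LHS]exchange_big.
  by apply: eq_bigr => i _; rewrite [RHS]sum_swap_pair.
Qed.

End AlongLines.


(** * Maximal sets of positivity *)

Lemma chain_contains_finite (T : Type) (F : set (set T)) l (x : 'I_l -> T) :
  F !=set0 -> total_on F subset -> (forall j, exists2 X, F X & X (x j)) ->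
  exists2 X, F X & forall j, X (x j).
Proof.
move=> [X0 FX0] F_total; elim: l x => [|l IH] x Fx.
  by exists X0 => // -[].
have [X FX Xx] := IH (fun j => x (lift ord0 j)) (fun j => Fx _).
have [Y FY Yx] := Fx ord0.
have [XY|YX] := F_total _ _ FX FY; [exists Y|exists X] => // j;
  case: (unliftP ord0 j) => [i|] ->//; first exact: XY.
exact: YX.
Qed.

Section Connectedness.
Variables (R : realType) (N : nat) (E : hilbertType R).
Local Notation C := R[i].
Local Notation mxtuple n := 'rV['M[C]_n]_N.
Variables (K : word N -> word N -> 'L(E)) (U : forall n, set (mxtuple n)).
Arguments U : clear implicits.

Lemma positive_kernel_sub (G : hilbertType R) (T : Type) (A B : set T)
    (k : T -> T -> 'L(G)) :
  A `<=` B -> positive_kernel B k -> positive_kernel A k.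
Proof. by move=> AB B_pos l x h xA; apply: B_pos => j; exact: AB. Qed.

Variable n : nat.
Implicit Types (p Z : mxtuple n) (A B : set (mxtuple n)).

Lemma entry_ball_nbhs p (r : C) : 0 < r -> nbhs p (entry_ball p r).
Proof. by move=> r0; rewrite entry_ballE//; exact: nbhsx_ballx. Qed.

Lemma entry_ball_sub p p' (r r' : C) :
  entry_ball p r p' -> entry_ball p' r' `<=` entry_ball p (r' + r).
Proof.
move=> pp' Z Zp' j a b.
apply: le_lt_trans (ler_distD (p' 0 j a b) _ _) _.
exact: ltrD.
Qed.

Lemma entry_ball_sym p p' (r : C) : entry_ball p r p' -> entry_ball p' r p.
Proof. by move=> pp' j a b; rewrite distrC. Qed.

Let good A := [/\ open A, A `<=` U n & positive_kernel A (nc_eval K (n := n))].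

Lemma maximal_good B0 : good B0 -> exists2 A, B0 `<=` A & good A /\
  forall B, A `<=` B -> good B -> B = A.
Proof.
(* Adjoining [B0] gives the empty chain an upper bound that contains [B0]. *)
move=> B0_good; pose P := [set A | good (A `|` B0)].
have [F FP F_total|A [A_good A_max]] := @Zorn_bigcup _ P.
  pose F' := [set B | B = B0 \/ exists2 X, F X & B = X `|` B0].
  have F'_good B : F' B -> good B by case=> [->//|[X FX ->]]; exact: FP.
  have F'_total : total_on F' subset.
    move=> _ _ [->|[X FX ->]] [->|[Y FY ->]]; [by left|left|right|].
    - exact: subsetUr.
    - exact: subsetUr.
    - by have [XY|YX] := F_total _ _ FX FY; [left|right]; exact: setSU.
  have F'E : \bigcup_(X in F) X `|` B0 = \bigcup_(B in F') B.
    apply/seteqP; split => [Z [[X FX XZ]|B0Z]|Z [B [->|[X FX ->]]]].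
    - by exists (X `|` B0); [right; exists X | left].
    - by exists B0; [left|].
    - by right.
    - by case=> [XZ|]; [left; exists X|right].
  rewrite /P /= F'E; split.
  - by apply: bigcup_open => B /F'_good[].
  - by move=> Z [B /F'_good[_ BU _]] /BU.
  - move=> l Z h ZF'.
    have F'0 : F' !=set0 by exists B0; left.
    have [B F'B BZ] := chain_contains_finite F'0 F'_total ZF'.
    by have [_ _ B_pos] := F'_good _ F'B; exact: B_pos.
exists (A `|` B0); first exact: subsetUr.
split=> // B AB B_good; apply/seteqP; split=> //.
have PB : P B.
  rewrite /P /= setUidl//; apply: subset_trans AB; exact: subsetUr.
apply: contrapT => BA; apply: A_max PB; split.
  by apply: subset_trans AB; exact: subsetUl.
by move=> BA'; apply: BA; apply: subset_trans BA' _; exact: subsetUl.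
Qed.

(** A maximal open set of positivity containing a neighbourhood of the origin is
    relatively closed, because positivity extends to a ball about any of its
    points whose radius depends only on the distance to the boundary of $U_n$. *)
Lemma positive_kernel_connected :
  nc_convergent K U -> open (U n) -> connected (U n) -> U n 0 ->
  positive_nc_kernel K -> positive_kernel (U n) (nc_eval K (n := n)).
Proof.
move=> K_cvg U_open U_connected U_0 K_pos.
have [r r0 rU] := open_entry_ball U_open U_0.
have r40 : 0 < r / 4 by rewrite divr_gt0.
have B0_pos : positive_kernel (entry_ball 0 (r / 4)) (nc_eval K (n := n)).
  by apply: (positive_kernel_near0 K_cvg) => //; rewrite mulrCA divff ?mulr1.
have B0_good : good (entry_ball 0 (r / 4))°.
  split; first exact: open_interior.
  - apply: subset_trans (@interior_subset _ _) _; apply: subset_trans rU => Z Zr j a b.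
    by apply: lt_le_trans (Zr j a b) _; rewrite ler_pdivrMr// ler_peMr ?ltW// ltr1n.
  - by apply: positive_kernel_sub B0_pos; exact: interior_subset.
have [Om B0Om [[Om_open OmU Om_pos] Om_max]] := maximal_good B0_good.
rewrite -(U_connected Om)//.
- by exists 0; apply: B0Om; exact: entry_ball_nbhs.
- by exists Om => //; rewrite setIidr.
exists (closure Om); first exact: closed_closure.
apply/seteqP; split=> [Z OmZ|p [Up Omp]].
  by split; [exact: OmU | exact: subset_closure].
have [R1 R10 R1U] := open_entry_ball U_open Up.
(* The ball of radius [4 * s] about a point within [s / 2] of [p] stays in the
   ball of radius [R1] about [p], and the ball of radius [s] contains [p]. *)
pose s := R1 / 5; pose s2 := s / 2.
have s0 : 0 < s by rewrite divr_gt0.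
have s20 : 0 < s2 by rewrite divr_gt0.
have [p' [Omp' pp']] := Omp _ (entry_ball_nbhs p s20).
have extended : positive_kernel (Om `|` entry_ball p' s) (nc_eval K (n := n)).
  apply: (positive_kernel_extend K_cvg) => //.
  apply: subset_trans (entry_ball_sub pp') _; apply: subset_trans R1U => Z ZR j a b.
  apply: lt_trans (ZR j a b) _; rewrite /s2 /s -subr_gt0.
  by rewrite (_ : _ - _ = R1 / 10) ?divr_gt0//; field.
rewrite -(Om_max (Om `|` (entry_ball p' s)°)).
- right; apply: filterS (entry_ball_nbhs p s20) => Z Zp.
  rewrite (_ : s = s2 + s2); last by rewrite /s2; field.
  exact: (entry_ball_sub (entry_ball_sym pp')).
- exact: subsetUl.
- split.
  + by apply: openU => //; exact: open_interior.
  + rewrite subUset; split=> //; apply: subset_trans (@interior_subset _ _) _.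
    apply: subset_trans R1U => Z Zp'.
    have := entry_ball_sub pp' Zp' => Zp j a b; apply: lt_trans (Zp j a b) _.
    rewrite /s2 /s -subr_gt0.
    by rewrite (_ : _ - _ = R1 * 7 / 10) ?divr_gt0 ?mulr_gt0//; field.
  + apply: positive_kernel_sub extended => Z [OmZ|Zp']; first by left.
    by right; exact: interior_subset.
Qed.

End Connectedness.

Theorem theorem2 (R : realType) (N : nat) (E : hilbertType R)
    (K : word N -> word N -> 'L(E))
    (U : forall n : nat, set 'rV['M[R[i]]_n]_N)
    (U_open : forall n, open (U n))
    (U_connected : forall n, connected (U n))
    (U_0 : forall n, U n 0)
    (K_cvg : nc_convergent K U) :
  positive_nc_kernel K <->
  forall n, positive_kernel (U n) (nc_eval K (n := n)).
Proof.
split=> [K_pos n|K_pos]; first exact: positive_kernel_connected.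
apply: positive_nc_kernel_words => D x D0.
exact: nc_eval_ge0_words U_open U_0 K_cvg K_pos D0.
Qed.
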